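(* Let $R = 1/(1+\ln 2)$. There is an absolute constant $C>0$ such that for every number of bins $n \ge 1$ and every input sequence $\sigma$ of the online multiple knapsack problem, the Rising Threshold Algorithm (RTA) described in the context satisfies $\mathrm{RTA}(\sigma) \ge (R - C/n)\cdot \mathrm{OPT}(\sigma)$. That is, RTA has competitive ratio at least $R - O(1/n)$.
   Context: Online multiple knapsack problem (proportional variant): there are $n$ bins, each of capacity $1$. Items with sizes in $(0,1]$ arrive one at a time. Upon arrival of an item, an online algorithm must irrevocably either reject it or place it into one bin, so that the total size (load) of each bin never exceeds $1$; placements cannot be changed later, and the algorithm does not know future items. For an algorithm $A$ and input $\sigma$, $A(\sigma)$ is the total size of the items accepted by $A$; $\mathrm{OPT}(\sigma)$ is the maximum total size of a subset of the items of $\sigma$ that can be feasibly packed into the $n$ bins. Constants and functions: $R = 1/(1+\ln 2)$, $\xi_c = (1+\tfrac23\ln\tfrac43)R - \tfrac23$, $\phi = \tfrac23 \xi_c/(\tfrac23 - R + \xi_c)\ (\approx 0.2191)$. $f:[0,1]\to[1/2,1]$, $f(x)=1/2$ if $x\le R$ and $f(x)=(2e)^{x-1}$ otherwise. $\xi:[\phi,1/2]\to\mathbb{R}$, $\xi(x)=\xi_c/x$ for $x\in[\phi,1/3]$ and $\xi(x)=9\xi_c(1-2x)$ for $x\in(1/3,1/2]$. An item is large if its size is in $(1/2,1]$, medium if in $[\phi,1/2]$, small if less than $\phi$. A medium item is in category $M_i$ ($i\in\{2,3,4\}$) if its size is in $(1/(i+1),1/i]$, except that $M_4$ consists of medium items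 of size in $[\phi,1/4]$. A (multi)set $Z$ of medium items is $\xi$-dominated if for every $z\in Z$, $|\{z'\in Z: z'\ge z\}| \le n\,\xi(z)$. Algorithm RTA: every bin carries a label among $E$ (empty), $A$ (auxiliary: small items of total load $<\phi$; at most one such bin), $S_*$ (small items), $M_S$ (a single marked medium item), $M_2,M_3,M_4$ (medium items of that category), $L_+$ (one large item plus possibly non-large items); initially all bins are $E$. RTA maintains a set $D$ of marked medium items, initially empty. Each item is processed as follows. - Large item $x$: let $k$ be the number of large items accepted so far. If $x < f((k+1)/n)$, reject it. Otherwise, if some $M_S$-bin has at least $x$ free space, put $x$ there and relabel it $L_+$; else put $x$ into an empty bin, labeled $L_+$. - Medium item $x$: if some $L_+$-bin has room for $x$, put it there. Else, if $D\cup\{x\}$ is $\xi$-dominated, add $x$ to $D$ (mark it) and put it into an empty bin, labeled $M_S$. Else, with $i$ its category, put it into an existing $M_i$-bin with room if one exists, otherwise into an empty bin labeled $M_i$. - Small item $x$: put it into an $L_+$-bin with room if one exists; else into an $S_*$-bin with room if one exists; else into the $A$-bin if it exists; else into an empty bin, relabeled $A$. If it was put into an already existing $A$-bin and that bin's load is now at least $\phi$: if $D\cup\{\ell\}$ is $\xi$-dominated, where $\ell$ is the bin's load, then all items of this bin are merged into a single medium item of size $\ell$, which is marked (added to $D$), and the bin is relabeled $M_S$ (from then on this merged item is treated as a single medium item); otherwise the bin is relabeled $S_*$. - After processing an item, if no empty bin remains, RTA terminates (accepts nothing further). When several bins qualify, any of them may be chosen. *)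

(* Defs.v *)
From HB Require Import structures.
From mathcomp Require Import all_boot all_order all_algebra.
From mathcomp Require Import reals sequences exp.

Set Implicit Arguments.
Unset Strict Implicit.
Unset Printing Implicit Defensive.

Import Order.TTheory GRing.Theory Num.Theory.
Local Open Scope ring_scope.

Section Constants.
Variable R : realType.
Implicit Type x : R.

Definition rta_ratio : R := 1 / (1 + ln 2).

Definition xi_c : R := (1 + 2 / 3 * ln (4 / 3)) * rta_ratio - 2 / 3.

Definition phi : R := (2 / 3 * xi_c) / (2 / 3 - rta_ratio + xi_c).

(* Only used on [0, 1]. *)
Definition threshold x : R :=
  if x <= rta_ratio then 1 / 2 else powR (2 * expR 1) (x - 1).

(* Only used on [phi, 1/2]. *)
Definition xi x : R :=
  if x <= 1 / 3 then xi_c / x else 9 * xi_c * (1 - 2 * x).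

Definition large x := 1 / 2 < x.
Definition medium x := phi <= x <= 1 / 2.
Definition small x := x < phi.

(* The multiset of medium items is represented by a sequence. *)
Definition xi_dominated (n : nat) (Z : seq R) : bool :=
  all (fun z => (count (fun z' => z <= z') Z)%:R <= n%:R * xi z) Z.

End Constants.

Section Opt.
Variables (R : realType) (n : nat) (s : seq R).

(* Items are referred to by their position in s, as sizes may repeat. *)
Definition packable (A : {set 'I_(size s)}) : bool :=
  [exists p : {ffun 'I_(size s) -> 'I_n},
    [forall j : 'I_n, \sum_(i in A | p i == j) s`_i <= 1]].

(* The default 0 of the maximum is the value of the empty subset. *)
Definition opt : R :=
  \big[Num.max/0]_(A : {set 'I_(size s)} | packable A) \sum_(i in A) s`_i.

End Opt.

(* The labels E, A, S_*, M_S, M_2, M_3, M_4 and L_+. *)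
Variant label := LE | LA | LS | LMS | LM2 | LM3 | LM4 | LL.

Lemma label_comparable : comparable label.
Proof. by move=> x y; rewrite /decidable; decide equality. Qed.

HB.instance Definition _ := hasDecEq.Build label (compareP label_comparable).

Section RTA.
Variables (R : realType) (n : nat).

Record bin := Bin { bin_label : label; bin_items : seq R }.

Definition load (b : bin) : R := \sum_(y <- bin_items b) y.

(* [marked] is the set D, which also contains the merged items;             *)
(* [accepted] lists the accepted input items, before any merging.           *)
Record state := State {
  bins : {ffun 'I_n -> bin};
  marked : seq R;
  accepted : seq R
}.

Definition rta_init : state := State [ffun _ => Bin LE [::]] [::] [::].

Definition rta_value (st : state) : R := \sum_(y <- accepted st) y.

Definition nlarge (st : state) : nat := count (@large R) (accepted st).

Definition labeled (st : state) (l : label) (j : 'I_n) : bool :=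
  bin_label (bins st j) == l.

Definition exists_labeled (st : state) (l : label) : bool :=
  [exists j, labeled st l j].

Definition fits (st : state) (l : label) (x : R) (j : 'I_n) : bool :=
  labeled st l j && (load (bins st j) + x <= 1).

Definition exists_fit (st : state) (l : label) (x : R) : bool :=
  [exists j, fits st l x j].

Definition category (x : R) : label :=
  if 1 / 3 < x then LM2 else if 1 / 4 < x then LM3 else LM4.

Definition set_bin (j : 'I_n) (b : bin) (st : state) : state :=
  State [ffun i => if i == j then b else bins st i] (marked st) (accepted st).

Definition put (x : R) (j : 'I_n) (l : label) (st : state) : state :=
  let st' := set_bin j (Bin l (x :: bin_items (bins st j))) st in
  State (bins st') (marked st') (x :: accepted st').

Definition mark (z : R) (st : state) : state :=
  State (bins st) (z :: marked st) (accepted st).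

(* The bins used are arbitrary among those that qualify, hence a relation.  *)
Variant rta_process (st : state) (x : R) : state -> Prop :=
| LargeReject of large x & x < threshold ((nlarge st).+1%:R / n%:R) :
    rta_process st x st
| LargeMS j of large x & threshold ((nlarge st).+1%:R / n%:R) <= x
    & fits st LMS x j :
    rta_process st x (put x j LL st)
| LargeEmpty j of large x & threshold ((nlarge st).+1%:R / n%:R) <= x
    & ~~ exists_fit st LMS x & labeled st LE j :
    rta_process st x (put x j LL st)
| MediumL j of medium x & fits st LL x j :
    rta_process st x (put x j LL st)
| MediumMark j of medium x & ~~ exists_fit st LL x
    & xi_dominated n (x :: marked st) & labeled st LE j :
    rta_process st x (mark x (put x j LMS st))
| MediumCategory j of medium x & ~~ exists_fit st LL x
    & ~~ xi_dominated n (x :: marked st) & fits st (category x) x j :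
    rta_process st x (put x j (category x) st)
| MediumEmpty j of medium x & ~~ exists_fit st LL x
    & ~~ xi_dominated n (x :: marked st) & ~~ exists_fit st (category x) x
    & labeled st LE j :
    rta_process st x (put x j (category x) st)
| SmallL j of small x & fits st LL x j :
    rta_process st x (put x j LL st)
| SmallS j of small x & ~~ exists_fit st LL x & fits st LS x j :
    rta_process st x (put x j LS st)
| SmallA j of small x & ~~ exists_fit st LL x & ~~ exists_fit st LS x
    & labeled st LA j & load (bins st j) + x < phi R :
    rta_process st x (put x j LA st)
| SmallMerge j (l := load (bins st j) + x) of
      small x & ~~ exists_fit st LL x & ~~ exists_fit st LS x
    & labeled st LA j & phi R <= l & xi_dominated n (l :: marked st) :
    rta_process st x (mark l (set_bin j (Bin LMS [:: l]) (put x j LMS st)))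
| SmallRelabel j (l := load (bins st j) + x) of
      small x & ~~ exists_fit st LL x & ~~ exists_fit st LS x
    & labeled st LA j & phi R <= l & ~~ xi_dominated n (l :: marked st) :
    rta_process st x (put x j LS st)
| SmallEmpty j of small x & ~~ exists_fit st LL x & ~~ exists_fit st LS x
    & ~~ exists_labeled st LA & labeled st LE j :
    rta_process st x (put x j LA st).

(* With n >= 1 an empty bin exists initially, so testing for one before     *)
(* each item amounts to testing after each item.                            *)
Variant rta_step (st : state) (x : R) : state -> Prop :=
| StepTerminated of ~~ exists_labeled st LE : rta_step st x st
| StepProcess st' of exists_labeled st LE & rta_process st x st' :
    rta_step st x st'.

Fixpoint rta_run (st : state) (s : seq R) (st' : state) : Prop :=
  if s is x :: s' then exists2 st1, rta_step st x st1 & rta_run st1 s' st'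
  else st' = st.

(* The relation is never stuck, so quantifying over runs is not vacuous.    *)
Lemma rta_step_total st x : exists st', rta_step st x st'.
Proof.
have [hE|hE] := boolP (exists_labeled st LE); last by exists st; left.
suff [st' h] : exists st', rta_process st x st' by exists st'; right.
have /existsP[e he] := hE.
have [xl|xm] := boolP (large x).
  have [xr|xa] := ltP x (threshold ((nlarge st).+1%:R / n%:R)).
    by eexists; apply: LargeReject.
  have [/existsP[j hj]|hn] := boolP (exists_fit st LMS x).
    by eexists; apply: (LargeMS (j := j)).
  by eexists; apply: (LargeEmpty (j := e)).
have [xs|xp] := ltP x (phi R).
  have [/existsP[j hj]|hL] := boolP (exists_fit st LL x).
    by eexists; apply: (SmallL (j := j)).
  have [/existsP[j hj]|hS] := boolP (exists_fit st LS x).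
    by eexists; apply: (SmallS (j := j)).
  have [/existsP[j hj]|hA] := boolP (exists_labeled st LA); last first.
    by eexists; apply: (SmallEmpty (j := e)).
  have [ls|lp] := ltP (load (bins st j) + x) (phi R).
    by eexists; apply: (SmallA (j := j)).
  have [hd|hd] := boolP (xi_dominated n (load (bins st j) + x :: marked st)).
    by eexists; apply: (SmallMerge (j := j)).
  by eexists; apply: (SmallRelabel (j := j)).
have xM : medium x by rewrite /medium xp /= leNgt.
have [/existsP[j hj]|hL] := boolP (exists_fit st LL x).
  by eexists; apply: (MediumL (j := j)).
have [hd|hd] := boolP (xi_dominated n (x :: marked st)).
  by eexists; apply: (MediumMark (j := e)).
have [/existsP[j hj]|hC] := boolP (exists_fit st (category x) x).
  by eexists; apply: (MediumCategory (j := j)).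
by eexists; apply: (MediumEmpty (j := e)).
Qed.

Lemma rta_run_total s st : exists st', rta_run st s st'.
Proof.
elim: s st => [|x s IHs] st; first by exists st.
have [st1 h1] := rta_step_total st x; have [st2 h2] := IHs st1.
by exists st2, st1.
Qed.

End RTA.

(* Main.v *)
(** If an empty bin remains, RTA has rejected only large items below
    [th := f ((k+1)/n)], where [k] large items were accepted. Each bin of OPT
    has at most one large item, so OPT exceeds the residual volume [V] (the
    non-large items and the excesses of large items over [th]) by at most
    [n th], while RTA collects [V] plus a sum of thresholds that is about
    [R n th].

    Otherwise all bins are used, and RTA collects [R n - O(1)]. Let [w] be the
    least item alone in an [M_S]-bin and [z] the least "tight" point, where the
    number of marked items of size at least [z] is [n xi(z) - O(1)]. Items
    that could not be marked have size at least [z], so that up to O(1) bins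
    the [S_*]- and [M_i]-bins have load at least [s = full_load z]. Each
    [L_+]-bin has load at least [1 - w] or contains a marked item. The total is
    then [n] times the area under [f] clamped to [[1 - w, s]], plus the
    contribution of the marked items, and the inequalities
    [area_tight_below], [area_tight_above] and [marked_bins_area] say that this
    is at least [R n]; these are the constraints that determine [xi] and
    [phi]. *)

Require Import Defs.
From mathcomp Require Import all_boot all_order all_algebra.
From mathcomp Require Import ring lra.
From mathcomp Require Import reals topology normedtype derive sequences exp.

Set Implicit Arguments.
Unset Strict Implicit.
Unset Printing Implicit Defensive.
Import Order.TTheory GRing.Theory Num.Theory.
Import numFieldNormedType.Exports.
Local Open Scope ring_scope.

(** * Bounds on the logarithm *)

Section Logarithm.
Variable R : realType.
Implicit Types x u : R.

Lemma le_of_derive_ge0 (f f' : R -> R) x : 0 <= x ->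
  (forall y : R, is_derive y 1 f (f' y)) -> (forall y, 0 <= f' y) -> f 0 <= f x.
Proof.
move=> x0 df f'0.
have der y : derivable f y 1 by have := df y.
apply: (@ger0_derive1_ndecr _ f 0 x) => // [y _|].
  by rewrite derive1E (@derive_val _ _ _ _ _ _ _ (df y)).
apply: continuous_subspaceT => y.
by apply/differentiable_continuous/derivable1_diffP.
Qed.

(** The derivatives compare because [a + b >= 2] when [a * b = 1] and [a > 0]. At [x = ln u] this is
    an upper bound on [ln u]. *)
Lemma sinh_ge x : 0 <= x -> 2 * x <= expR x - expR (- x).
Proof.
move=> x0; rewrite -subr_ge0.
pose f := fun y : R => expR y - expR (- y) - 2 * y.
pose f' := fun y : R => expR y + expR (- y) - 2.
have -> : 0 = f 0 by rewrite /f oppr0 expR0; ring.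
apply: (@le_of_derive_ge0 f f') => // y; last first.
  rewrite /f'; have := expR_gt0 y; have : expR y * expR (- y) = 1.
    by rewrite -expRD subrr expR0.
  move: (expR y) (expR (- y)) => a b ab a0.
  have : 0 <= (a - 1) ^+ 2 * b.
    by rewrite mulr_ge0 ?sqr_ge0 //; nra.
  nra.
rewrite /f /f'; apply: is_derive_eq; rewrite /GRing.scale /=; ring.
Qed.

(** The difference has derivative [1 + (y - 1) * expR y], nonnegative by [1 - y <= expR (- y)]. At
    [x = ln u] it becomes the Pade bound on [ln u]. *)
Lemma tanh_le x : 0 <= x -> 2 * (expR x - 1) <= x * (expR x + 1).
Proof.
move=> x0; rewrite -subr_ge0.
pose f := fun y : R => y * (expR y + 1) - 2 * (expR y - 1).
pose f' := fun y : R => 1 + (y - 1) * expR y.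
have -> : 0 = f 0 by rewrite /f expR0; ring.
apply: (@le_of_derive_ge0 f f') => // y; last first.
  rewrite /f'; have := expR_gt0 y; have := expR_ge1Dx (- y).
  have : expR y * expR (- y) = 1 by rewrite -expRD subrr expR0.
  move: (expR y) (expR (- y)) => a b; nra.
rewrite /f /f'; apply: is_derive_eq; rewrite /GRing.scale /=; ring.
Qed.

Lemma ln_ge1V u : 0 < u -> 1 - u^-1 <= ln u.
Proof.
move=> u0; have := @le_ln1Dx R (u^-1 - 1).
rewrite (_ : 1 + (u^-1 - 1) = u^-1); last by ring.
rewrite lnV ?posrE// => H.
have : 0 < u^-1 by rewrite invr_gt0.
by move=> ?; have := H ltac:(lra); lra.
Qed.

Lemma ln_ge_pade u : 1 <= u -> 2 * (u - 1) / (u + 1) <= ln u.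
Proof.
move=> u1; have u0 : 0 < u by lra.
have := tanh_le (ln_ge0 u1).
by rewrite lnK ?posrE // ler_pdivrMr //; lra.
Qed.

Lemma ln_le_sinh u : 1 <= u -> ln u <= (u - u^-1) / 2.
Proof.
move=> u1; have u0 : 0 < u by lra.
have := sinh_ge (ln_ge0 u1).
by rewrite expRN lnK ?posrE //; lra.
Qed.

(** The midpoint and trapezoid rules for the integral of [1/x] over [[a, a + 1]]; they are the Pade
    and sinh bounds at [u = (a + 1) / a]. *)
Lemma ln_natS_bounds (a : nat) : (0 < a)%N ->
  2 / a.*2.+1%:R <= ln a.+1%:R - ln a%:R :> R /\
  ln a.+1%:R - ln a%:R <= (a%:R^-1 + a.+1%:R^-1) / 2 :> R.
Proof.
move=> a0; have A0 : 0 < a%:R :> R by rewrite ltr0n.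
have A1 : 0 < a.+1%:R :> R by rewrite ltr0n.
rewrite -ln_div ?posrE //; set u := a.+1%:R / a%:R.
have uE : u = 1 + a%:R^-1 by rewrite /u -natr1 mulrDl mulfV ?gt_eqF // mul1r.
have u1 : 1 <= u by rewrite uE lerDl invr_ge0 ltW.
have nz : a%:R != 0 :> R by rewrite gt_eqF.
have -> : a.*2.+1%:R = 2 * a%:R + 1 :> R by rewrite -natr1 -mul2n natrM.
split.
  apply: le_trans (ln_ge_pade u1); rewrite uE.
  suff -> : 2 * (1 + a%:R^-1 - 1) / (1 + a%:R^-1 + 1) = 2 / (2 * a%:R + 1) :> R by [].
  by field; rewrite nz andbT /=; apply: lt0r_neq0; lra.
apply: le_trans (ln_le_sinh u1) _; rewrite uE -[a.+1%:R]natr1.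
suff -> : (1 + a%:R^-1 - (1 + a%:R^-1)^-1) / 2 = (a%:R^-1 + (a%:R + 1)^-1) / 2 :> R by [].
by field; rewrite nz andbT; apply: lt0r_neq0; lra.
Qed.

Lemma ln_natD_bounds (a m : nat) : (0 < a)%N ->
  \sum_(i < m) (2 / (a + i).*2.+1%:R) <= ln (a + m)%:R - ln a%:R :> R /\
  ln (a + m)%:R - ln a%:R <=
    \sum_(i < m) (((a + i)%:R^-1 + (a + i).+1%:R^-1) / 2) :> R.
Proof.
move=> a0; elim: m => [|m [IH1 IH2]]; first by rewrite !big_ord0 addn0 subrr.
rewrite !big_ord_recr /= addnS.
have [] := @ln_natS_bounds (a + m); first by rewrite addn_gt0 a0.
have E (x y z : R) : x - z = x - y + (y - z) by ring.
by move=> H1 H2; rewrite (E _ (ln (a + m)%:R)) [_ - _ + (_ - _)]addrC; split; apply: lerD.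
Qed.

Lemma ln2_bounds : 79 / 114 <= ln 2 :> R /\ ln 2 <= 43 / 62 :> R.
Proof.
have [] := @ln_natD_bounds 16 16 isT.
have -> : ln (16 + 16)%:R - ln 16%:R = ln 2 :> R.
  by rewrite -ln_div ?posrE ?ltr0n //; congr ln; field.
rewrite !big_ord_recr !big_ord0 /= !addnS !addn0 !doubleS double0 => H1 H2; split; lra.
Qed.

Lemma ln43_bounds : 23 / 80 <= ln (4 / 3) :> R /\ ln (4 / 3) <= 17 / 59 :> R.
Proof.
have [] := @ln_natD_bounds 12 4 isT.
have -> : ln (12 + 4)%:R - ln 12%:R = ln (4 / 3) :> R.
  by rewrite -ln_div ?posrE ?ltr0n //; congr ln; field.
rewrite !big_ord_recr !big_ord0 /= !addnS !addn0 !doubleS double0 => H1 H2; split; lra.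
Qed.

End Logarithm.

(** * Constants and threshold *)

Section Constants.
Variable R : realType.
Local Notation rho := (rta_ratio R).
Local Notation xc := (xi_c R).
Local Notation phi := (phi R).
Implicit Types (x t s : R).

Lemma rta_ratioE : rho * (1 + ln 2) = 1.
Proof.
have [? _] := ln2_bounds R.
by rewrite /rta_ratio mul1r mulVf //; apply: lt0r_neq0; lra.
Qed.

Lemma rta_ratio_bounds : 49 / 83 <= rho <= 114 / 193.
Proof. have := ln2_bounds R; have := rta_ratioE; case=> ? ?; apply/andP; split; nra. Qed.

Lemma xi_c_bounds : 7 / 190 <= xc <= 3 / 80.
Proof.
have /andP[? ?] := rta_ratio_bounds; have [? ?] := ln43_bounds R.
rewrite /xi_c; apply/andP; split; nra.
Qed.

Lemma phiE : phi * (2 / 3 - rho + xc) = 2 / 3 * xc.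
Proof.
have /andP[? ?] := rta_ratio_bounds; have /andP[? ?] := xi_c_bounds.
by rewrite /Defs.phi mulfVK //; apply: lt0r_neq0; lra.
Qed.

Lemma phi_bounds : 3 / 14 <= phi <= 13 / 59.
Proof.
have /andP[? ?] := rta_ratio_bounds; have /andP[? ?] := xi_c_bounds.
have := phiE => pE; apply/andP; split; nra.
Qed.

(** This form shows [3 * xi_c] to be the slope of the chord of [rho * s * (1 - ln s)] between [2/3]
    and [1]. *)
Lemma xi_cE : xc = rho / 3 + 2 / 3 * (rho * ln (2 / 3)).
Proof.
have -> : ln (2 / 3) = ln (4 / 3) - ln 2 :> R.
  by rewrite -ln_div ?posrE; [congr ln; field|lra|lra].
have := rta_ratioE; rewrite /xi_c; lra.
Qed.

Lemma xi_ge0 x : 0 < x -> x <= 1 / 2 -> 0 <= xi x.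
Proof.
have /andP[? ?] := xi_c_bounds => x0 x2; rewrite /xi; case: ifP => _.
  by rewrite divr_ge0 //; lra.
nra.
Qed.

(** Since [2e = exp (1 / rho)], the exponential branch is [expR ((x - 1) / rho)]. It equals [1/2] at
    [x = rho], so the case split is a maximum. *)
Lemma thresholdE x : threshold x = Num.max (1 / 2) (expR ((x - 1) / rho)).
Proof.
have /andP[? ?] := rta_ratio_bounds.
have e2 : expR ((rho - 1) / rho) = 1 / 2.
  have -> : (rho - 1) / rho = - ln 2.
    rewrite mulrBl mulfV; last by apply: lt0r_neq0; lra.
    by rewrite /rta_ratio mul1r div1r invrK; ring.
  by rewrite expRN lnK ?posrE ?mul1r.
rewrite /threshold; case: leP => xr.
  rewrite max_l // -e2 ler_expR ler_pM2r ?invr_gt0; lra.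
rewrite max_r; last by rewrite -e2 ler_expR ler_pM2r ?invr_gt0; lra.
have e0 : 0 < expR 1 :> R by apply: expR_gt0.
rewrite /powR gt_eqF; last by rewrite mulr_gt0.
congr expR; congr (_ * _).
rewrite lnM ?posrE // expRK /rta_ratio mul1r invrK; ring.
Qed.

Lemma threshold_ge_half x : 1 / 2 <= threshold x.
Proof. by rewrite thresholdE le_max lexx. Qed.

Lemma threshold_ge_exp x : expR ((x - 1) / rho) <= threshold x.
Proof. by rewrite thresholdE le_max lexx orbT. Qed.

Lemma threshold_le1 x : x <= 1 -> threshold x <= 1.
Proof.
have /andP[? ?] := rta_ratio_bounds => x1.
rewrite thresholdE ge_max; apply/andP; split; first lra.
by rewrite expR_le1 pmulr_lle0 ?invr_gt0; lra.
Qed.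

Lemma threshold_homo : {homo @threshold R : x y / x <= y}.
Proof.
have /andP[? ?] := rta_ratio_bounds => x y xy.
rewrite !thresholdE ge_max le_max lexx /= le_max; apply/orP; right.
rewrite ler_expR ler_pM2r ?invr_gt0; lra.
Qed.

End Constants.

(** * Riemann sums of the clamped threshold *)

Section ClampedExponential.
Variable R : realType.
Implicit Types u v a b : R.

Lemma expR_chord u v : expR v - expR u <= expR v * (v - u).
Proof.
have := expR_ge1Dx (u - v); rewrite expRB => H.
have v0 : 0 < expR v := expR_gt0 v.
have : (1 + (u - v)) * expR v <= expR u by rewrite -ler_pdivlMr.
lra.
Qed.

Definition clamp a b v : R := Num.min (Num.max v a) b.

(** An antiderivative of [v |-> expR (clamp a b v)]: the summands vary below [a], between [a] and
    [b], and above [b], respectively. *)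
Definition clamp_exp_primitive a b v : R :=
  expR a * Num.min v a + expR (clamp a b v) + expR b * Num.max (v - b) 0.

Lemma clamp_exp_primitive_le a b u v : a <= b -> u <= v ->
  clamp_exp_primitive a b v - clamp_exp_primitive a b u
    <= expR (clamp a b v) * (v - u).
Proof.
move=> ab uv; rewrite /clamp_exp_primitive /clamp.
have ea : 0 < expR a := expR_gt0 a; have eb : 0 < expR b := expR_gt0 b.
have [va|av] := leP v a.
  rewrite (min_l ab) (max_r (_ : u <= a)); last lra.
  rewrite (min_l (_ : u <= a)); last lra.
  rewrite (min_l ab) !max_r; [lra|lra|lra].
have eav : expR a <= expR v by rewrite ler_expR ltW.
have [vb|bv] := leP v b.
  rewrite (max_r (_ : v - b <= 0)); last lra.
  rewrite (max_r (_ : u - b <= 0)); last lra.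
  have [ua|au] := leP u a.
    rewrite (min_l ab); have := expR_chord a v; nra.
  rewrite (min_l (_ : u <= b)); last lra.
  have := expR_chord u v; nra.
have eab : expR a <= expR b by rewrite ler_expR.
rewrite (max_l (_ : 0 <= v - b)); last lra.
have [ua|au] := leP u a.
  rewrite (min_l ab) (max_r (_ : u - b <= 0)); last lra.
  have := expR_chord a b; nra.
have [ub|bu] := leP u b.
  rewrite (max_r (_ : u - b <= 0)); last lra.
  have := expR_chord u b; nra.
rewrite (max_l (_ : 0 <= u - b)); lra.
Qed.

Lemma clamp_exp_sum a b c h (m : nat) : a <= b -> 0 <= h ->
  clamp_exp_primitive a b (c + m%:R * h) - clamp_exp_primitive a b c
    <= h * \sum_(i < m) expR (clamp a b (c + i.+1%:R * h)).
Proof.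
move=> ab h0; elim: m => [|m IH]; first by rewrite big_ord0 mul0r mulr0 addr0 subrr.
rewrite big_ord_recr /= mulrDr.
have := @clamp_exp_primitive_le a b (c + m%:R * h) (c + m.+1%:R * h) ab.
have -> : c + m.+1%:R * h - (c + m%:R * h) = h by rewrite -[m.+1%:R]natr1; ring.
rewrite [expR _ * h]mulrC => /(_ _) H.
have {}H := H ltac:(by rewrite lerD2l ler_wpM2r // ler_nat).
rewrite -(subrK (clamp_exp_primitive a b (c + m%:R * h))
  (clamp_exp_primitive a b (c + m.+1%:R * h))).
by rewrite -addrA addrC lerD.
Qed.

End ClampedExponential.

Section Thresholds.
Variable R : realType.
Local Notation rho := (rta_ratio R).
Implicit Types t s : R.

(* The main term of [\sum_(i < n) min (max (threshold (i.+1 / n)) t) s]. *)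
Definition clamped_area t s : R := rho * (t * ln (2 * t) + s * (1 - ln s)).

(** With [v = (x - 1) / rho] the threshold is at least [expR v], and the sum over all [n] indices is
    a right Riemann sum of the clamped exponential on [[-1/rho, 0]]. The last [n - k] terms, each at
    most [s], are given away. *)
Lemma clamped_threshold_sum (n k : nat) t s : (k <= n)%N -> (0 < n)%N ->
  1 / 2 <= t -> t <= s -> s <= 1 ->
  n%:R * clamped_area t s - (n - k)%:R * s <=
    \sum_(i < k) Num.min (Num.max (threshold (i.+1%:R / n%:R)) t) s.
Proof.
move=> kn n0 t2 ts s1.
have /andP[r1 r2] := rta_ratio_bounds R.
have N0 : 0 < n%:R :> R by rewrite ltr0n.
have nz1 : (rho != 0) && (n%:R != 0 :> R).
  by rewrite !gt_eqF //; lra.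
have t0 : 0 < t by lra.
have s0 : 0 < s by lra.
have tE : expR (ln t) = t by rewrite lnK.
have sE : expR (ln s) = s by rewrite lnK.
have lts : ln t <= ln s by rewrite ler_ln.
have ls0 : ln s <= 0 by rewrite ln_le0.
have rV : rho^-1 = 1 + ln 2 by rewrite /rta_ratio mul1r invrK.
have lt2 : ln (2 * t) = ln 2 + ln t by rewrite lnM ?posrE.
have l2t : 0 <= ln (2 * t) by rewrite ln_ge0 //; lra.
have h0 : 0 <= (n%:R * rho)^-1 by rewrite invr_ge0 mulr_ge0 //; lra.
have := @clamp_exp_sum R _ _ (- rho^-1) (n%:R * rho)^-1 n lts h0.
have -> : - rho^-1 + n%:R * (n%:R * rho)^-1 = 0.
  by field; rewrite nz1.
have -> : clamp_exp_primitive (ln t) (ln s) 0 = t * ln t + s + s * - ln s.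
  rewrite /clamp_exp_primitive /clamp tE sE (min_r (_ : ln t <= 0)); last lra.
  by rewrite (max_l (_ : ln t <= 0)); [rewrite (min_r ls0) sE sub0r max_l //; lra|lra].
have -> : clamp_exp_primitive (ln t) (ln s) (- rho^-1) = t * - rho^-1 + t.
  have ? : - rho^-1 <= ln t by lra.
  rewrite /clamp_exp_primitive /clamp tE sE min_l //.
  by rewrite max_r // (min_l lts) tE max_r ?mulr0 ?addr0 //; lra.
rewrite [(_ * _)^-1 * _]mulrC ler_pdivlMr; last by rewrite mulr_gt0 //; lra.
rewrite /clamped_area lt2.
set S := \sum_(i < n) _ => H.
have S_le : S <= \sum_(i < k) Num.min (Num.max (threshold (i.+1%:R / n%:R)) t) s
    + (n - k)%:R * s.
  have cle v : expR (clamp (ln t) (ln s) v) <= s.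
    by rewrite -[leRHS]sE ler_expR /clamp ge_min lexx orbT.
  rewrite /S -!(big_mkord xpredT (fun i => expR (clamp _ _ (_ + i.+1%:R * _)))).
  rewrite (@big_cat_nat _ _ _ k) //= big_mkord; apply: lerD.
    apply: ler_sum => i _; set v := _ + _.
    have vE : v = (i.+1%:R / n%:R - 1) / rho.
      by rewrite /v; field; rewrite nz1.
    rewrite /clamp le_min -{3}sE ler_expR ge_min lexx orbT andbT.
    apply: (@le_trans _ _ (expR (Num.max v (ln t)))).
      by rewrite ler_expR ge_min lexx.
    have [_|_] := leP v (ln t); first by rewrite tE le_max lexx orbT.
    by rewrite le_max vE threshold_ge_exp.
  apply: (@le_trans _ _ (\sum_(k <= i < n) s)); first by apply: ler_sum.
  by rewrite sumr_const_nat mulr_natl.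
rewrite -/S in H *; move: S_le H; set T := \sum_(i < k) _ => S_le H.
rewrite lerBlDr; apply: le_trans S_le.
by apply: le_trans H; rewrite le_eqVlt; apply/orP; left; apply/eqP; rewrite rV; ring.
Qed.

End Thresholds.

(** * Area inequalities *)

Section Areas.
Variable R : realType.
Local Notation rho := (rta_ratio R).
Local Notation xc := (xi_c R).
Local Notation phi := (phi R).
Implicit Types s t w z : R.

(** The right side is convex, and the left side is its tangent at [1/2]. *)
Lemma xlnx_ge t : 0 < t -> t - 1 / 2 <= t * ln (2 * t).
Proof.
move=> t0; have t20 : 0 < 2 * t by lra.
have := ln_ge1V t20.
have : t * (2 * t)^-1 = 1 / 2 by rewrite invfM mulrCA mulfV ?gt_eqF // mulr1 div1r.
nra.
Qed.

(* Chord of the concave map [s |-> s (1 - ln s)] between 2/3 and 1. *)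
Lemma entropy_chord s : 2 / 3 <= s -> s <= 1 ->
  rho - 3 * xc * (1 - s) <= rho * (s * (1 - ln s)).
Proof.
move=> s1 s2; have /andP[r1 r2] := rta_ratio_bounds R.
have s0 : 0 < s by lra.
have H1 := ln_ge1V (_ : 0 < 2 / 3 / s); have {}H1 := H1 ltac:(by rewrite divr_gt0 //; lra).
have H2 := ln_ge1V (_ : 0 < s^-1); have {}H2 := H2 ltac:(by rewrite invr_gt0).
rewrite ln_div ?posrE in H1; [|lra|lra].
rewrite lnV ?posrE // invrK in H2.
have e : (2 / 3 / s)^-1 = 3 / 2 * s by field; rewrite gt_eqF.
rewrite e in H1.
(* [s] is the convex combination of [2/3] and [1] with weight [3 * (1 - s)] on [2/3]. The summands
   are the weighted gaps, at [2/3] and at [1], between the tangent at [s] and the concave map. *)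
have : 0 <= 3 * (1 - s) * (2 / 3) * (ln (2 / 3) - ln s - (1 - 3 / 2 * s))
    + (1 - 3 * (1 - s)) * (- ln s - (1 - s)).
  by apply: addr_ge0; apply: mulr_ge0; lra.
rewrite xi_cE; move: (ln (2 / 3)) (ln s) => l m.
set e1 := (X in 0 <= X) => h; set e2 := (X in X <= _); set e3 := (X in _ <= X).
rewrite -subr_ge0; have -> : e3 - e2 = rho * e1 by rewrite /e1 /e2 /e3; field.
by apply: mulr_ge0 => //; lra.
Qed.

(** The Pade bound at [1/s], for use at [s = 1 - phi], where [entropy_chord] loses too much. *)
Lemma entropy_pade s : 0 < s -> s <= 1 ->
  s + 2 * s * (1 - s) / (1 + s) <= s * (1 - ln s).
Proof.
move=> s0 s1; have sV : 1 <= s^-1 by rewrite invf_ge1.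
have := ln_ge_pade sV; rewrite lnV ?posrE //.
have -> : 2 * (s^-1 - 1) / (s^-1 + 1) = 2 * (1 - s) / (1 + s).
  field; rewrite !gt_eqF //; lra.
move=> H; rewrite [s * (1 - ln s)]mulrBr mulr1 -mulrN lerD2l.
rewrite (_ : 2 * s * (1 - s) / (1 + s) = s * (2 * (1 - s) / (1 + s))); last by ring.
by rewrite ler_wpM2l // ltW.
Qed.

Lemma clamped_area_ge w s : w <= 1 / 2 ->
  rho * (1 / 2 - w) + rho * (s * (1 - ln s)) <= clamped_area (1 - w) s.
Proof.
move=> w2; have /andP[r1 r2] := rta_ratio_bounds R.
have h := @xlnx_ge (1 - w) ltac:(lra).
rewrite /clamped_area [leRHS]mulrDr lerD2r ler_wpM2l //; lra.
Qed.

(** The right side is the average load if [n * xi w] bins have load [w] and all others [2/3]. As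
    [xi w * w = xi_c], it is least at [w = phi], where [phiE] makes it equal to the ratio; this
    determines [phi]. *)
Lemma marked_bins_area w : phi <= w -> w <= 1 / 3 ->
  rho <= 2 / 3 - xi w * (2 / 3 - w).
Proof.
move=> pw w3; have /andP[r1 r2] := rta_ratio_bounds R.
have /andP[x1 x2] := xi_c_bounds R; have /andP[p1 p2] := phi_bounds R.
have pE := phiE R.
rewrite /xi w3; have w0 : 0 < w by lra.
have : xc / w * w = xc by rewrite mulfVK ?gt_eqF.
have : xc / w <= 3 / 2 * (2 / 3 - rho + xc).
  rewrite ler_pdivrMr //; nra.
move: (xc / w) => q; lra.
Qed.

(* A lower bound for the load of all but O(1) of the S_*- and M_i-bins when  *)
(* z is tight: the middle case is needed only if S_*-bins exist, which      *)
(* forces z <= 2 phi.                                                       *)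
Definition full_load z : R :=
  if z <= 1 / 3 then 2 / 3
  else if z <= 2 * phi then Num.min (2 * z) (1 - phi) else 2 * z.

Lemma full_load_bounds z : z <= 1 / 2 -> 2 / 3 <= full_load z <= 1.
Proof.
move=> z2; have /andP[p1 p2] := phi_bounds R; rewrite /full_load.
case: (leP z (1 / 3)) => z3; first lra.
case: (leP z (2 * phi)) => zp; last lra.
by case: (leP (2 * z) (1 - phi)) => zq; lra.
Qed.

(** A marked item of size at least [z] adds [z + w - 1/2] to the bound for its L_+-bin. Each of the
    at most [n * xi w] M_S-bins has load [w] instead of [full_load z] and may hold such an item
    without this gain, which costs [z - 1/2 + full_load z] in all. *)
Lemma area_tight_below w z : phi <= z -> z <= w -> 1 / 3 < w -> w <= 1 / 2 ->
  rho <= clamped_area (1 - w) (full_load z) + xi z * (z + w - 1 / 2)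
         - xi w * (z - 1 / 2 + full_load z).
Proof.
move=> pz zw w3 w2; have /andP[r1 r2] := rta_ratio_bounds R.
have /andP[x1 x2] := xi_c_bounds R; have /andP[p1 p2] := phi_bounds R.
have /andP[s1 s2] := @full_load_bounds z ltac:(lra).
have H1 := @clamped_area_ge w (full_load z) w2.
have H2 := @entropy_chord (full_load z) s1 s2.
have H3 := @entropy_pade (full_load z) ltac:(lra) s2.
have -> : xi w = 9 * xc * (1 - 2 * w) by rewrite /xi leNgt w3.
move: s1 s2 H1 H2 H3; rewrite /full_load /xi.
case: (leP z (1 / 3)) => z3 s1 s2.
  move: (clamped_area _ _) (rho * (_ * (1 - ln _))) => a h H1 H2 _.
  (* The chord at [2/3] loses [xi_c], which [xi z * z = xi_c] regains; everything left has the
     factor [1/2 - w]. *)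
  have z0 : 0 < z by lra.
  have : xc / z * z = xc by rewrite mulfVK ?gt_eqF.
  have : xc / z <= 3 / 16.
    rewrite ler_pdivrMr //; lra.
  move: (xc / z) => q q1 q2.
  have h1 : 0 <= (1 / 2 - w) * (rho - q - 9 * xc) by apply: mulr_ge0; lra.
  have h2 : 0 <= (1 / 2 - w) * (18 * xc * (1 / 3 - z)).
    by apply: mulr_ge0; [lra|apply: mulr_ge0; lra].
  nra.
have bcase a h : rho * (1 / 2 - w) + h <= a -> rho - 3 * xc * (1 - 2 * z) <= h ->
    rho <= a + 9 * xc * (1 - 2 * z) * (z + w - 1 / 2)
           - 9 * xc * (1 - 2 * w) * (z - 1 / 2 + 2 * z).
  move=> H1 H2.
  have [d E] : exists d, z = 1 / 2 - d by exists (1 / 2 - z); ring.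
  have [e E'] : exists e, w = 1 / 2 - e by exists (1 / 2 - w); ring.
  rewrite {}E {}E' in pz zw w3 w2 z3 H1 H2 *.
  have d6 : d <= 1 / 6 by lra.
  have e0 : 0 <= e by lra.
  have ed : e <= d by lra.
  suff : 0 <= rho * e + 18 * xc * (d * (1 / 6 - d) - e * (1 - 2 * d)) by nra.
  have h1 : 0 <= (rho - 15 * xc) * e by apply: mulr_ge0; lra.
  have h2 : 0 <= xc * ((d - e) * (1 / 6 - d) + e * d).
    by apply: mulr_ge0; [lra|apply: addr_ge0; apply: mulr_ge0; lra].
  nra.
case: (leP z (2 * phi)) s1 s2 => zp s1 s2.
  case: (leP (2 * z) (1 - phi)) s1 s2 => zq s1 s2 H1 H2 H3; first exact: bcase H1 H2.
  (* The chord bound is too weak here: the slack is below 1/400. *)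
  have H4 : rho * ((1 - phi) + 2 * (1 - phi) * (1 - (1 - phi)) / (1 + (1 - phi)))
    <= clamped_area (1 - w) (1 - phi) - rho * (1 / 2 - w).
    rewrite lerBrDl; apply: le_trans H1; rewrite lerD2l ler_wpM2l //; lra.
  have [d E] : exists d, z = 1 / 2 - d by exists (1 / 2 - z); ring.
  have [e E'] : exists e, w = 1 / 2 - e by exists (1 / 2 - w); ring.
  (* [z <= 2 * phi] gives [d >= 1/2 - 2 * 13/59 = 7/118]; a concave function is least at an end
     point. *)
  have H5 : 13 / 500 <= d * (1 / 2 - d).
    have : 0 <= (d - 7 / 118) * (1 / 6 - d) by apply: mulr_ge0; lra.
    nra.
  have H6 : 35 / 36 <= (1 - phi) + 2 * (1 - phi) * (1 - (1 - phi)) / (1 + (1 - phi)).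
    rewrite -lerBlDl ler_pdivlMr; nra.
  have h0 : 18 * xc * (1 - phi) <= rho.
    have : 0 <= (3 / 80 - xc) * (1 - phi) by apply: mulr_ge0; lra.
    lra.
  have h1 : 0 <= e * (rho - 18 * xc * (1 - phi)) by apply: mulr_ge0; lra.
  have h2 : 0 <= xc * (d * (1 / 2 - d) - 13 / 500) by apply: mulr_ge0; lra.
  have h3 : 35 / 36 * rho <= clamped_area (1 - w) (1 - phi) - rho * (1 / 2 - w).
    by apply: le_trans H4; rewrite mulrC ler_wpM2l //; lra.
  rewrite {}E {}E' in h3 *; lra.
by move=> H1 H2 H3; exact: bcase H1 H2.
Qed.

(** A marked item of size at least [z] exceeds [w] by at least [z - w] in an M_S-bin, and its gain
    [z + w - 1/2] in an L_+-bin is no smaller. So [z - w] is credited wherever it lies, and an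
    M_S-bin costs only [full_load z - w]. *)
Lemma area_tight_above w z : w <= z -> z <= 1 / 2 -> 1 / 3 < w ->
  rho <= clamped_area (1 - w) (full_load z) + xi z * (z - w)
         - xi w * (full_load z - w).
Proof.
move=> wz z2 w3; have /andP[r1 r2] := rta_ratio_bounds R.
have /andP[x1 x2] := xi_c_bounds R; have /andP[p1 p2] := phi_bounds R.
have /andP[s1 s2] := @full_load_bounds z z2.
have H1 := @clamped_area_ge w (full_load z) ltac:(lra).
have H2 := @entropy_chord (full_load z) s1 s2.
have H3 := @entropy_pade (full_load z) ltac:(lra) s2.
move: s1 s2 H1 H2 H3; rewrite /full_load /xi.
have -> : (z <= 1 / 3) = false by apply/negP => ?; lra.
have -> : (w <= 1 / 3) = false by apply/negP => ?; lra.
have bcase a h : rho * (1 / 2 - w) + h <= a -> rho - 3 * xc * (1 - 2 * z) <= h ->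
    rho <= a + 9 * xc * (1 - 2 * z) * (z - w) - 9 * xc * (1 - 2 * w) * (2 * z - w).
  move=> H1 H2.
  have [d E] : exists d, z = 1 / 2 - d by exists (1 / 2 - z); ring.
  have [e E'] : exists e, w = 1 / 2 - e by exists (1 / 2 - w); ring.
  rewrite {}E {}E' in wz z2 w3 H1 H2 *.
  have e6 : e <= 1 / 6 by lra.
  have d0 : 0 <= d by lra.
  have de : d <= e by lra.
  suff : 0 <= rho * e + 18 * xc * (3 * d * e - d / 3 - d * d - e / 2 - e * e) by nra.
  have h1 : 0 <= (rho - 15 * xc) * e by apply: mulr_ge0; lra.
  have h2 : 0 <= xc * ((e - d) * (1 / 3 - e) + d * (2 * e - d)).
    by apply: mulr_ge0; [lra|apply: addr_ge0; apply: mulr_ge0; lra].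
  nra.
case: (leP z (2 * phi)) => zp; last by move=> s1 s2 H1 H2 H3; exact: bcase H1 H2.
case: (leP (2 * z) (1 - phi)) => zq s1 s2 H1 H2 H3; first exact: bcase H1 H2.
have H4 : rho * ((1 - phi) + 2 * (1 - phi) * (1 - (1 - phi)) / (1 + (1 - phi)))
    <= clamped_area (1 - w) (1 - phi) - rho * (1 / 2 - w).
  rewrite lerBrDl; apply: le_trans H1; rewrite lerD2l ler_wpM2l //; lra.
have H6 : 35 / 36 <= (1 - phi) + 2 * (1 - phi) * (1 - (1 - phi)) / (1 + (1 - phi)).
  rewrite -lerBlDl ler_pdivlMr; nra.
have h3 : 35 / 36 * rho <= clamped_area (1 - w) (1 - phi) - rho * (1 / 2 - w).
  by apply: le_trans H4; rewrite mulrC ler_wpM2l //; lra.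
have [d E] : exists d, z = 1 / 2 - d by exists (1 / 2 - z); ring.
have [e E'] : exists e, w = 1 / 2 - e by exists (1 / 2 - w); ring.
rewrite {}E {}E' in wz z2 w3 zp h3 *.
have h4 : 0 <= (3 / 80 - xc) * (e * (1 / 2 - phi + e)).
  by apply: mulr_ge0; [lra|apply: mulr_ge0; lra].
have h5 : 0 <= (e - 7 / 118) * (1 / 6 - e) by apply: mulr_ge0; lra.
have h6 : 0 <= xc * (d * (e - d)) by apply: mulr_ge0; [lra|apply: mulr_ge0; lra].
have h7 : 0 <= e * (phi - 3 / 14) by apply: mulr_ge0; lra.
have h8 : 0 <= e * (rho - 49 / 83) by apply: mulr_ge0; lra.
nra.
Qed.

End Areas.

(** * The invariant of RTA *)

Section Invariant.
Variables (R : realType) (n : nat).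
Local Notation rho := (rta_ratio R).
Local Notation phi := (phi R).
Implicit Types (st : state R n) (b : bin R) (x z : R) (j : 'I_n).

(* At most one low bin of each class exists at any time. *)
Definition low b : bool :=
  match bin_label b with
  | LA => true
  | LS => load b <= 1 - phi
  | LM2 => load b <= 1 / 2
  | LM3 | LM4 => load b <= 2 / 3
  | _ => false
  end.

(** [LA] and [LS] share a class: an A-bin is opened only for a small item that fits into no S_*-bin,
    so no S_*-bin is low then. The last class collects the labels that are never low. *)
Definition label_class (l : label) : 'I_5 :=
  match l with
  | LA | LS => Ordinal (isT : 0 < 5)%N
  | LM2 => Ordinal (isT : 1 < 5)%N
  | LM3 => Ordinal (isT : 2 < 5)%N
  | LM4 => Ordinal (isT : 3 < 5)%N
  | _ => Ordinal (isT : 4 < 5)%N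
  end.

(* [g] is the size of the marked item of the bin (0 if there is none), [lg]  *)
(* that of its large item, and [z0] bounds the unmarked medium items below.  *)
Definition bin_ok z0 b g lg : Prop :=
  match bin_label b with
  | LE => bin_items b = [::] /\ g = 0
  | LA => g = 0 /\ 0 <= load b < phi
  | LS => g = 0 /\ 0 <= load b
  | LMS => load b = g /\ phi <= g <= 1 / 2
  | LM2 | LM3 | LM4 => g = 0 /\
      all (fun y => [&& z0 <= y, medium y & category y == bin_label b])
        (bin_items b)
  | LL => [/\ lg + g <= load b, 1 / 2 < lg & g = 0 \/ phi <= g <= 1 / 2]
  end.

(** The weights [v] in [inv_large] and [inv_threshold] let sums over L_+-bins pass to thresholds
    under any monotone clamp. [inv_count] asks [0 < z] because [g j = 0] encodes the absence of a
    marked item. The tight point [z0] starts at [1/2], where [xi] vanishes, and only decreases. *)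
Record invariant st (g lg : 'I_n -> R) z0 : Prop := Invariant {
  inv_value : rta_value st = \sum_j load (bins st j);
  inv_bin : forall j, bin_ok z0 (bins st j) (g j) (lg j);
  inv_dominated : xi_dominated n (marked st);
  inv_medium : all (@medium R) (marked st);
  inv_count : forall z, 0 < z ->
    count (fun y => z <= y) (marked st) = (\sum_j (z <= g j)%R)%N;
  inv_mem : forall j, 0 < g j -> g j \in marked st;
  inv_large : forall v : R -> R,
    \sum_(j | labeled st LL j) v (lg j) = \sum_(x <- accepted st | large x) v x;
  inv_threshold : forall v : R -> R, {homo v : x y / x <= y} ->
    \sum_(i < nlarge st) v (threshold (i.+1%:R / n%:R))
      <= \sum_(x <- accepted st | large x) v x;
  inv_separated : forall i j, labeled st LL i -> labeled st LMS j ->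
    phi <= g i \/ 1 < load (bins st i) + load (bins st j);
  inv_low : forall i j, low (bins st i) -> low (bins st j) ->
    label_class (bin_label (bins st i)) = label_class (bin_label (bins st j)) ->
    i = j;
  inv_z0 : phi <= z0 <= 1 / 2;
  inv_tight : n%:R * xi z0 - 1 <= (count (fun y => z0 <= y) (marked st))%:R;
  inv_small : forall j, labeled st LS j -> z0 <= 2 * phi
}.

Lemma load_cons l x s : load (Bin l (x :: s)) = x + \sum_(y <- s) y.
Proof. by rewrite /load /= big_cons. Qed.

Lemma bin_ok_load_ge0 z0 b g lg : bin_ok z0 b g lg -> 0 <= load b.
Proof.
have /andP[p1 p2] := phi_bounds R.
have A s (P : pred R) : all (fun y => [&& z0 <= y, medium y & P y]) s ->
    0 <= \sum_(y <- s) y.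
  move=> /allP h; rewrite big_seq_cond; apply: sumr_ge0 => y.
  by rewrite andbT => /h /and3P[_ /andP[? _] _]; lra.
case: b => -[] s; rewrite /bin_ok /=.
- by move=> [-> _]; rewrite /load big_nil.
- by move=> [_ /andP[]].
- by move=> [].
- by move=> [-> ]; lra.
- by move=> [_ /A].
- by move=> [_ /A].
- by move=> [_ /A].
- by move=> [h1 h2 [h3|h3]]; lra.
Qed.

Lemma bin_ok_marked_ge0 z0 b g lg : bin_ok z0 b g lg -> 0 <= g.
Proof.
have /andP[p1 p2] := phi_bounds R.
case: b => -[] s; rewrite /bin_ok /=; by move=> [? ?]; lra.
Qed.

(** Inserting [x] raises only the counts at points [z <= x], each by one, so a constraint that it
    violates was tight up to 1 before. *)
Lemma xi_dominated_tight (D : seq R) x :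
  xi_dominated n D -> all (@medium R) D -> medium x ->
  ~~ xi_dominated n (x :: D) ->
  exists2 z, phi <= z <= x & n%:R * xi z - 1 <= (count (fun y => z <= y) D)%:R.
Proof.
move=> /allP dD /allP mD mx /allPn[z]; rewrite -ltNge /= => zin.
rewrite natrD => hz.
have zx : z <= x.
  rewrite leNgt; apply/negP => xz; move: zin; rewrite inE => /orP[/eqP zE|zD].
    by rewrite zE ltxx in xz.
  by move: hz; rewrite (lt_geF xz) add0r ltNge (dD z zD).
exists z; last by move: hz; rewrite zx /= => hz; lra.
rewrite zx andbT; move: zin; rewrite inE => /orP[/eqP ->|/mD /andP[]//].
by case/andP: mx.
Qed.

(** Lowering [z0] weakens all that mentions it except tightness and [phi <= z0], which
    [xi_dominated_tight] supplies for the new point. *)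
Lemma invariant_tighten st g lg z0 x :
  invariant st g lg z0 -> medium x -> ~~ xi_dominated n (x :: marked st) ->
  exists2 z, z <= x & invariant st g lg z.
Proof.
move=> I mx nd.
have [z /andP[pz zx] tz] := xi_dominated_tight (inv_dominated I) (inv_medium I) mx nd.
have [z0z|zz0] := leP z0 z; first by exists z0; [exact: le_trans zx|].
exists z => //; case: I => I1 I2 I3 I4 I5 I6 I7 I8 I9 I10 I11 I12 I13; split => //.
- move=> j; have := I2 j; rewrite /bin_ok.
  case: (bin_label _) => //.
  + move=> [-> /allP h]; split=> //; apply/allP => y /h /and3P[h1 -> ->].
    by rewrite !andbT; apply: le_trans h1; exact: ltW.
  + move=> [-> /allP h]; split=> //; apply/allP => y /h /and3P[h1 -> ->].
    by rewrite !andbT; apply: le_trans h1; exact: ltW.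
  + move=> [-> /allP h]; split=> //; apply/allP => y /h /and3P[h1 -> ->].
    by rewrite !andbT; apply: le_trans h1; exact: ltW.
- by rewrite pz /=; case/andP: I11 => _; apply: le_trans; exact: ltW.
- by move=> j /I13; apply: le_trans; exact: ltW.
Qed.

Definition update {T : Type} (f : 'I_n -> T) j a : 'I_n -> T :=
  fun i => if i == j then a else f i.

(** Every accepting rule changes one bin, so each reduces to side conditions on that bin. The load
    equation does not fix the items of [b'], which also admits merging. *)
Lemma invariant_step st g lg z0 j b' x gj lgj D' :
  invariant st g lg z0 ->
  load b' = load (bins st j) + x ->
  bin_ok z0 b' gj lgj ->
  (D' = marked st /\ gj = g j) \/
    [/\ D' = gj :: marked st, g j = 0, medium gj & xi_dominated n (gj :: marked st)] ->
  [/\ ~~ large x, (bin_label b' == LL) = labeled st LL j & lgj = lg j] \/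
    [/\ large x, bin_label b' = LL, ~~ labeled st LL j, lgj = x
      & threshold ((nlarge st).+1%:R / n%:R) <= x] ->
  (bin_label b' = LL -> forall i, labeled st LMS i -> i != j ->
    phi <= gj \/ 1 < load b' + load (bins st i)) ->
  (bin_label b' = LMS -> forall i, labeled st LL i -> i != j ->
    phi <= g i \/ 1 < load (bins st i) + load b') ->
  (low b' -> (low (bins st j) /\
      label_class (bin_label b') = label_class (bin_label (bins st j))) \/
    (forall i, low (bins st i) ->
      label_class (bin_label (bins st i)) != label_class (bin_label b'))) ->
  (bin_label b' = LS -> z0 <= 2 * phi) ->
  invariant (State [ffun i => if i == j then b' else bins st i] D' (x :: accepted st))
    (update g j gj) (update lg j lgj) z0.
Proof.
move=> [I1 I2 I3 I4 I5 I6 I7 I8 I9 I10 I11 I12 I13] ld ok hD hx hL hMS hlow hS.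
have /andP[p1 p2] := phi_bounds R.
have upd T (f : 'I_n -> T) a i : i != j -> update f j a i = f i.
  by rewrite /update => /negPf ->.
have updj T (f : 'I_n -> T) a : update f j a j = a by rewrite /update eqxx.
split => /=.
- rewrite /rta_value /= big_cons -/(rta_value st) I1.
  rewrite (bigD1 j) //= [in RHS](bigD1 j) //= ffunE eqxx ld.
  rewrite addrA [x + _]addrC; congr (_ + _).
  by apply: eq_bigr => i /negPf ij; rewrite ffunE ij.
- move=> i; rewrite ffunE /update; case: eqP => // _.
- by case: hD => [[-> _]|[-> _ _]].
- by case: hD => [[-> _]|[-> _ /= -> _]].
- move=> z z0'; rewrite (bigD1 j) //= updj (eq_bigr (fun i => nat_of_bool (z <= g i)));
    last by move=> i ij; rewrite upd.
  have E := I5 z z0'; rewrite (bigD1 j) //= in E.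
  case: hD => [[-> ->]|[-> gj0 _ _]]; first by rewrite E.
  by rewrite /= E gj0 (lt_geF z0').
- move=> i; have [->|ij] := eqVneq i j; rewrite ?updj ?upd //.
    by case: hD => [[-> ->]|[-> _ _ _]]; [exact: I6|rewrite inE eqxx].
  move=> /I6; case: hD => [[-> _]//|[-> _ _ _]] h.
  by rewrite inE h orbT.
- move=> v; rewrite big_cons -I7.
  have split_j (P : pred 'I_n) (F : 'I_n -> R) :
      \sum_(i | P i) F i = (if P j then F j else 0) + \sum_(i | P i && (i != j)) F i.
    by rewrite big_mkcond (bigD1 j) //= big_mkcondl.
  rewrite [LHS]split_j [in RHS]split_j {1}/labeled /= ffunE eqxx updj.
  have -> : \sum_(i | labeled (State [ffun i => if i == j then b' else bins st i] D'
      (x :: accepted st)) LL i && (i != j)) v (update lg j lgj i) =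
      \sum_(i | labeled st LL i && (i != j)) v (lg i).
    apply: eq_big => [i|i /andP[_ ij]]; last by rewrite upd.
    by rewrite /labeled /= ffunE; case: (i == j); rewrite ?andbF.
  case: hx => [[/negPf -> -> ->] //|[-> -> /negPf -> -> _]].
  by rewrite eqxx add0r.
- move=> v hv; rewrite big_cons /nlarge /= -/(nlarge st).
  case: hx => [[/negPf -> _ _]|[-> _ _ _ h]]; first exact: I8.
  by rewrite add1n big_ord_recr /= addrC lerD // ?hv // I8.
- move=> i k; rewrite /labeled /= !ffunE.
  have [->|ij] := eqVneq i j; have [_|kj] := eqVneq k j; rewrite ?updj ?upd //.
  + by move=> /eqP -> /eqP.
  + by move=> /eqP h1 h2; exact: hL.
  + by move=> h1 /eqP h2; exact: hMS.
  + by move=> h1 h2; exact: I9.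
- move=> i k; rewrite !ffunE.
  have [->|ij] := eqVneq i j; have [->|kj] := eqVneq k j => //.
  + move=> /hlow [[l1 ->]|h] l2 e; first by rewrite (I10 _ _ l1 l2 e).
    by have := h k l2; rewrite e eqxx.
  + move=> l2 /hlow [[l1 ->]|h] e; first by rewrite (I10 _ _ l2 l1 e).
    by have := h i l2; rewrite e eqxx.
  + exact: I10.
- by [].
- apply: le_trans I12 _; rewrite ler_nat.
  by case: hD => [[-> _]//|[-> _ _ _]] /=; rewrite leq_addl.
- move=> i; rewrite /labeled /= ffunE; case: (i == j); last exact: I13.
  by move=> /eqP; exact: hS.
Qed.

End Invariant.

(** * Preservation of the invariant under the rules of RTA *)

Section Preservation.
Variables (R : realType) (n : nat).
Local Notation phi := (phi R).
Implicit Types (st : state R n) (b : bin R) (x z : R) (j : 'I_n).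

Lemma medium_not_large x : medium x -> ~~ large x.
Proof. by rewrite /medium /large -leNgt => /andP[]. Qed.

Lemma small_not_large x : small x -> ~~ large x.
Proof.
have /andP[p1 p2] := phi_bounds R.
by rewrite /small /large -leNgt => ?; lra.
Qed.

Lemma category_cases x : [\/ category x = LM2, category x = LM3 | category x = LM4].
Proof.
rewrite /category; case: ifP => _; first exact: Or31.
by case: ifP => _; [exact: Or32|exact: Or33].
Qed.

Lemma bin_ok_category z0 x s g lg :
  bin_ok z0 (Bin (category x) s) g lg <->
  g = 0 /\ all (fun y => [&& z0 <= y, medium y & category y == category x]) s.
Proof. by rewrite /bin_ok /=; case: (category_cases x) => ->. Qed.

Lemma category_neq_LL x : category x != LL.
Proof. by apply/eqP; case: (category_cases x) => ->. Qed.

Lemma low_category_cons x s : 0 < x ->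
  low (Bin (category x) (x :: s)) -> low (Bin (category x) s).
Proof.
move=> x0; rewrite /low /= load_cons /load /=.
by case: (category x) => // h; apply: le_trans h; rewrite lerDr ltW.
Qed.

(** The limits in [low] complement the largest size of the category: [1/2 + 1/2] and [2/3 + 1/3].
    Hence no category bin is opened while a low one of its class exists. *)
Lemma low_category_fits x b : medium x -> low b ->
  label_class (bin_label b) = label_class (category x) ->
  bin_label b = category x /\ load b + x <= 1.
Proof.
move=> /andP[_ x2]; rewrite /low /category.
case: leP => x3; [case: leP => x4|]; case: (bin_label b) => //= h _; split=> //; lra.
Qed.

Lemma no_fit st l x i : ~~ exists_fit st l x -> labeled st l i ->
  1 < load (bins st i) + x.
Proof.
rewrite negb_exists => /forallP /(_ i); rewrite /fits => + li.
by rewrite li /= -ltNge.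
Qed.

Lemma rta_process_invariant st x st' g lg z0 :
  0 < x -> invariant st g lg z0 -> rta_process st x st' ->
  exists g' lg' z0', invariant st' g' lg' z0'.
Proof.
move=> x0 I; have /andP[p1 p2] := phi_bounds R.
have load_put l j : load (Bin l (x :: bin_items (bins st j))) = load (bins st j) + x.
  by rewrite load_cons addrC.
have ok j l : labeled st l j -> bin_label (bins st j) = l /\
    bin_ok z0 (bins st j) (g j) (lg j) by move=> /eqP ->; split => //; exact: inv_bin.
have nLL j l : labeled st l j -> l <> LL -> (labeled st LL j) = false.
  by move=> /eqP h; rewrite /labeled h => /eqP /negPf.
have into_L j : ~~ large x -> fits st LL x j ->
    exists g' lg' z0', invariant (put x j LL st) g' lg' z0'.
  move=> xl /andP[lj fj]; have [lE okj] := ok _ _ lj.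
  exists (update g j (g j)), (update lg j (lg j)), z0.
  apply: (invariant_step I (load_put _ _)) => //=; try by left.
  - by move: okj; rewrite /bin_ok lE /= load_put => -[h1 h2 h3]; split=> //; lra.
  - by left; split=> //; rewrite lj eqxx.
  - move=> _ i iMS _; rewrite load_put; case: (inv_separated I lj iMS) => h; [left|right]; lra.
case=> [xl xr|j xl xa /andP[lj fj]|j xl xa nf lj|j xm fj|j xm nf dom lj
  |j xm nf nd /andP[lj fj]|j xm nf nd nc lj|j xs fj|j xs nf /andP[lj fj]
  |j xs nf nS lj la|j l xs nf nS lj la dom|j l xs nf nS lj la nd|j xs nf nS nA lj].
- by exists g, lg, z0.
(* The marked item stays in the bin, so [g j] is kept and the new L_+-bin meets the first
   alternative of [inv_separated]. *)
- have [lE okj] := ok _ _ lj; move: okj; rewrite /bin_ok lE => -[h1 h2].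
  exists (update g j (g j)), (update lg j x), z0.
  apply: (invariant_step I (load_put _ _)) => //=; try by left.
  + by rewrite /bin_ok /= load_put; split; [lra| |right].
  + by right; split=> //; rewrite (nLL _ _ lj).
  + by move=> _ i _ _; left; lra.
- have [lE okj] := ok _ _ lj; move: okj; rewrite /bin_ok lE => -[h1 h2].
  exists (update g j (g j)), (update lg j x), z0.
  apply: (invariant_step I (load_put _ _)) => //=; try by left.
  + by rewrite /bin_ok /= load_put /load h1 big_nil h2; split; [lra| |left].
  + by right; split=> //; rewrite (nLL _ _ lj).
  + move=> _ i iMS _; right; rewrite load_put /load h1 big_nil -/(load _).
    by have := no_fit nf iMS; lra.
- exact: into_L (medium_not_large xm) fj.
- have [lE okj] := ok _ _ lj; move: okj; rewrite /bin_ok lE => -[h1 h2].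
  exists (update g j x), (update lg j (lg j)), z0.
  apply: (invariant_step I (load_put _ _)) => //=.
  + by rewrite /bin_ok /= load_put /load h1 big_nil add0r.
  + by right; split.
  + left; split=> //; first exact: medium_not_large.
    by rewrite (nLL _ _ lj) //; apply/eqP.
  + move=> _ i iL _; right; rewrite load_put [load (bins st j)]/load h1 big_nil add0r.
    exact: no_fit nf iL.
(* The refusal to mark [x] yields a tight point [z <= x], so [x] meets the size bound for category
   bins. *)
- have [z zx I'] := invariant_tighten I xm nd.
  exists (update g j (g j)), (update lg j (lg j)), z.
  have bE : bins st j = Bin (category x) (bin_items (bins st j)).
    by case: (bins st j) (eqP lj) => l s /= ->.
  have := inv_bin I' j; rewrite bE => /bin_ok_category [h1 h2].
  apply: (invariant_step I' (load_put _ _)) => //=; try by left.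
  + by apply/bin_ok_category; split=> //=; rewrite zx xm eqxx.
  + left; split=> //; first exact: medium_not_large.
    by rewrite (nLL _ _ lj) ?(negPf (category_neq_LL x)) //; apply/eqP/category_neq_LL.
  + by move=> h; have := category_neq_LL x; rewrite h eqxx.
  + by case: (category_cases x) => ->.
  + by move=> /(low_category_cons x0); rewrite -bE => ?; left; rewrite (eqP lj).
  + by case: (category_cases x) => ->.
- have [z zx I'] := invariant_tighten I xm nd.
  exists (update g j (g j)), (update lg j (lg j)), z.
  have [lE okj] := ok _ _ lj; move: okj; rewrite /bin_ok lE => -[h1 h2].
  apply: (invariant_step I' (load_put _ _)) => //=; try by left.
  + by apply/bin_ok_category; split=> //=; rewrite h1 /= zx xm eqxx.
  + left; split=> //; first exact: medium_not_large.
    by rewrite (nLL _ _ lj) ?(negPf (category_neq_LL x)).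
  + by move=> h; have := category_neq_LL x; rewrite h eqxx.
  + by case: (category_cases x) => ->.
  + move=> _; right => i lowi; apply/eqP => /(low_category_fits xm lowi) [e1 e2].
    have := no_fit nc (i := i); rewrite /labeled e1 eqxx => /(_ isT); lra.
  + by case: (category_cases x) => ->.
- exact: into_L (small_not_large xs) fj.
- have [lE okj] := ok _ _ lj; move: okj; rewrite /bin_ok lE => -[h1 h2].
  exists (update g j (g j)), (update lg j (lg j)), z0.
  apply: (invariant_step I (load_put _ _)) => //=; try by left.
  + by rewrite /bin_ok /= load_put; split=> //; lra.
  + left; split=> //; first exact: small_not_large.
    by rewrite (nLL _ _ lj) //; apply/eqP.
  + by rewrite /low /= load_put lE => h; left; split=> //; lra.
  + by move=> _; exact: inv_small I _ lj.
- have [lE okj] := ok _ _ lj; move: okj; rewrite /bin_ok lE => -[h1 h2].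
  exists (update g j (g j)), (update lg j (lg j)), z0.
  apply: (invariant_step I (load_put _ _)) => //=; try by left.
  + by rewrite /bin_ok /= load_put; split=> //; lra.
  + left; split=> //; first exact: small_not_large.
    by rewrite (nLL _ _ lj) //; apply/eqP.
  + by move=> _; left; rewrite /low lE.
- have [lE okj] := ok _ _ lj; move: okj; rewrite /bin_ok lE => -[h1 h2].
  have ml : medium l by rewrite /medium la /=; rewrite /small in xs; rewrite /l; lra.
  exists (update g j l), (update lg j (lg j)), z0.
  have -> : mark l (set_bin j (Bin LMS [:: l]) (put x j LMS st)) =
      State [ffun i => if i == j then Bin LMS [:: l] else bins st i]
        (l :: marked st) (x :: accepted st).
    rewrite /mark /set_bin /=; congr State; apply/ffunP => i; rewrite !ffunE.
    by case: eqP.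
  have lE' : load (Bin LMS [:: l]) = l by rewrite load_cons big_nil addr0.
  apply: (invariant_step I lE') => //=.
  + by right; split.
  + left; split=> //; first exact: small_not_large.
    by rewrite (nLL _ _ lj) //; apply/eqP.
  (* No L_+-bin had room for [x], hence none has room for the merged [l >= x]. *)
  + move=> _ i iL _; right; rewrite lE'.
    by have := no_fit nf iL; rewrite /l; lra.
- have [lE okj] := ok _ _ lj; move: okj; rewrite /bin_ok lE => -[h1 h2].
  (* The refusal to mark [l] yields a tight point at most [l], hence at most [2 * phi]; this is what
     [inv_small] records. *)
  have l2p : l <= 2 * phi by rewrite /small in xs; rewrite /l; lra.
  have ml : medium l by rewrite /medium la /=; lra.
  have [z zx I'] := invariant_tighten I ml nd.
  exists (update g j (g j)), (update lg j (lg j)), z.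
  apply: (invariant_step I' (load_put _ _)) => //=; try by left.
  + by rewrite /bin_ok /= load_put; split=> //; lra.
  + left; split=> //; first exact: small_not_large.
    by rewrite (nLL _ _ lj) //; apply/eqP.
  + by move=> _; left; rewrite /low lE.
  + by move=> _; exact: le_trans zx l2p.
- have [lE okj] := ok _ _ lj; move: okj; rewrite /bin_ok lE => -[h1 h2].
  exists (update g j (g j)), (update lg j (lg j)), z0.
  apply: (invariant_step I (load_put _ _)) => //=; try by left.
  + rewrite /bin_ok /= load_put /load h1 big_nil add0r; split=> //.
    by rewrite (ltW x0).
  + left; split=> //; first exact: small_not_large.
    by rewrite (nLL _ _ lj) //; apply/eqP.
  + move=> _; right => i; rewrite /low.
    case E: (bin_label (bins st i)) => // hS.
      by move: nA; rewrite negb_exists => /forallP /(_ i); rewrite /labeled E eqxx.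
    have := no_fit nS (i := i); rewrite /labeled E eqxx => /(_ isT).
    by rewrite /small in xs; lra.
Qed.

Lemma xi_half : xi (1 / 2 : R) = 0.
Proof.
rewrite /xi; case: leP => h; first lra.
by rewrite (_ : 1 - 2 * (1 / 2) = 0 :> R) ?mulr0 //; field.
Qed.

Lemma rta_init_invariant : invariant (rta_init R n) (fun=> 0) (fun=> 0) (1 / 2).
Proof.
have /andP[p1 p2] := phi_bounds R.
have lab l j : labeled (rta_init R n) l j -> l = LE.
  by rewrite /labeled /= ffunE => /eqP.
split=> //=.
- rewrite /rta_value big_nil big1 // => j _.
  by rewrite ffunE /load big_nil.
- by move=> j; rewrite ffunE.
- by move=> z z0; rewrite big1 // => j _; rewrite (lt_geF z0).
- by move=> j; rewrite ltxx.
- move=> v; rewrite big_nil big1 // => j /lab //.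
- by move=> v _; rewrite big_ord0 big_nil.
- by move=> i j /lab.
- by move=> i j; rewrite ffunE.
- by rewrite lexx andbT; lra.
- by rewrite xi_half mulr0; lra.
- by move=> j /lab.
Qed.

Lemma rta_run_invariant (s : seq R) st st' g lg z0 :
  (forall x, x \in s -> 0 < x) -> invariant st g lg z0 -> rta_run st s st' ->
  exists g' lg' z0', invariant st' g' lg' z0'.
Proof.
elim: s st g lg z0 => [|x s IH] st g lg z0 s0 I /=; first by move=> ->; exists g, lg, z0.
have s0' y : y \in s -> 0 < y by move=> h; apply: s0; rewrite inE h orbT.
case=> st1 [_|st2 _ h] hr; first exact: IH s0' I hr.
have [g1 [lg1 [z1 I1]]] := rta_process_invariant (s0 x (mem_head _ _)) I h.
exact: IH s0' I1 hr.
Qed.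

End Preservation.

(** * No empty bin remains *)

Section FullBins.
Variables (R : realType) (n : nat).
Local Notation rho := (rta_ratio R).
Local Notation phi := (phi R).
Implicit Types (st : state R n) (j : 'I_n).

(** Items of size at most [1/2] exceed a total of [1/2] only if there are at least two of them. *)
Lemma two_items_load z (s : seq R) : 0 <= z ->
  all (fun y => z <= y <= 1 / 2) s -> 1 / 2 < \sum_(y <- s) y ->
  2 * z <= \sum_(y <- s) y.
Proof.
case: s => [|a [|b s]] z0 /=; first by rewrite big_nil; lra.
  by rewrite big_cons big_nil => ? ?; lra.
move=> /and3P[/andP[h1 _] /andP[h2 _] /allP h3] _; rewrite !big_cons.
have : 0 <= \sum_(y <- s) y.
  rewrite big_seq_cond; apply: sumr_ge0 => y; rewrite andbT => /h3 /andP[? _]; lra.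
lra.
Qed.

(** If [y >= z], then [l + y] is at least [1/2 + z] and [l + z], which covers both values of the
    maximum. If [phi <= y < z], then [l + y > 1/2 + phi > 2/3 > 1 - w]. *)
Lemma large_bin_load (z w l y ld : R) :
  phi <= z -> 1 / 3 < w -> w <= 1 / 2 -> l + y <= ld -> 1 / 2 < l ->
  y = 0 \/ phi <= y <= 1 / 2 -> phi <= y \/ 1 - w <= ld ->
  Num.max l (1 - w) + (z + w - 1 / 2) * (z <= y)%R%:R <= ld.
Proof.
have /andP[p1 p2] := phi_bounds R.
move=> z1 w3 w2 h1 h2 h3 h4.
case: (leP z y) => h5; rewrite ?mulr1 ?mulr0 ?addr0;
  case: (leP l (1 - w)) => h6; case: h3 => h3; case: h4 => h4; lra.
Qed.

Variables (st : state R n) (g lg : 'I_n -> R) (z0 : R).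
Hypotheses (n_gt0 : (0 < n)%N) (I : invariant st g lg z0).
Hypothesis no_empty : ~~ exists_labeled st LE.

Local Notation isL := (labeled st LL).
Local Notation isM := (labeled st LMS).
Local Notation isO := (fun j => ~~ isL j && ~~ isM j).

(** A non-low M_2-bin holds two items of size at least [1/3] and [z0]. If [z0 > 1/3], no M_3- or
    M_4-bin is non-low, since its items would belong to M_2. *)
Lemma full_load_le j : isO j -> ~~ low (bins st j) -> full_load z0 <= load (bins st j).
Proof.
have /andP[p1 p2] := phi_bounds R; have /andP[z1 z2] := inv_z0 I.
have := inv_bin I j; have := @inv_small _ _ _ _ _ _ I j.
move: no_empty; rewrite negb_exists => /forallP /(_ j).
rewrite /labeled /low /bin_ok; case E: (bin_label _) => //=; rewrite ?eqxx ?andbF //.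
- move=> _ /(_ isT) zp _ _; rewrite -ltNge /full_load => h.
  case: (leP z0 (1 / 3)) => h1; first lra.
  by rewrite zp; case: (leP (2 * z0) (1 - phi)) => h2; lra.
- move=> _ _ [_ /allP h] _; rewrite -ltNge => l2.
  have h3 y : y \in bin_items (bins st j) -> 1 / 3 <= y.
    by move=> /h /and3P[_ _]; rewrite /category; case: ltP => [/ltW//|_];
      case: ifP => _ /eqP.
  rewrite /full_load; case: (leP z0 (1 / 3)) => h1.
    have := @two_items_load (1 / 3) (bin_items (bins st j)); rewrite -/(load _).
    move=> H; apply: le_trans (H _ _ _); [lra|lra| |exact: l2].
    by apply/allP => y yin; rewrite h3 //=; have /and3P[_ /andP[_]] := h y yin.
  apply: (@le_trans _ _ (2 * z0)).
    by case: ifP => // _; rewrite ge_min lexx.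
  apply: two_items_load l2; first lra.
  by apply/allP => y yin; have /and3P[-> /andP[_]] := h y yin.
- move=> _ _ [_ /allP h] _; rewrite -ltNge => l2.
  rewrite /full_load; case: (leP z0 (1 / 3)) => h1; first lra.
  case: (bins st j) h l2 => l [|y s] /= h; first by rewrite /load big_nil; lra.
  have /and3P[zy _] := h y (mem_head _ _).
  have y3 : 1 / 3 < y by lra.
  by rewrite /category y3 => /eqP.
- move=> _ _ [_ /allP h] _; rewrite -ltNge => l2.
  rewrite /full_load; case: (leP z0 (1 / 3)) => h1; first lra.
  case: (bins st j) h l2 => l [|y s] /= h; first by rewrite /load big_nil; lra.
  have /and3P[zy _] := h y (mem_head _ _).
  have y3 : 1 / 3 < y by lra.
  by rewrite /category y3 => /eqP.
Qed.

Lemma low_count : (\sum_j low (bins st j) <= 5)%N.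
Proof.
rewrite -big_mkcond /= sum1_card.
rewrite -(@card_in_imset _ _ (fun j => label_class (bin_label (bins st j)))).
  by rewrite (leq_trans (max_card _)) // card_ord.
move=> i j li lj; exact: inv_low I _ _ li lj.
Qed.

Lemma other_load (c : R) : c <= full_load z0 ->
  c * (\sum_(j | isO j) 1) - 5 <= \sum_(j | isO j) load (bins st j).
Proof.
move=> cf; have /andP[z1 z2] := inv_z0 I.
have /andP[s1 s2] := @full_load_bounds R z0 z2.
rewrite lerBlDr mulr_sumr.
apply: (@le_trans _ _ (\sum_(j | isO j) (load (bins st j) + (low (bins st j))%:R))).
  apply: ler_sum => j Oj; rewrite mulr1.
  have := bin_ok_load_ge0 (inv_bin I j).
  have [lj|nlj] := boolP (low (bins st j)); rewrite ?addr0 /=; first lra.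
  by have := full_load_le Oj nlj; lra.
rewrite big_split /= lerD2l.
apply: (@le_trans _ _ (\sum_j (low (bins st j))%:R)).
  rewrite [leRHS](bigID isO) /= lerDl; apply: sumr_ge0 => j _; exact: ler0n.
by rewrite -natr_sum ler_nat low_count.
Qed.

Lemma sum_LMO (F : 'I_n -> R) :
  \sum_j F j = \sum_(j | isL j) F j + \sum_(j | isM j) F j + \sum_(j | isO j) F j.
Proof.
rewrite (bigID isL) /= -addrA; congr (_ + _).
rewrite (bigID isM) /=; congr (_ + _); apply: eq_bigl => j.
by rewrite /labeled; case: (bin_label (bins st j) =P LMS) => [->|]; rewrite ?andbF //;
  rewrite andbT; apply/eqP.
Qed.

Lemma nlargeE : \sum_(j | isL j) 1 = (nlarge st)%:R :> R.
Proof. by rewrite (inv_large I (fun=> 1)) /nlarge -sum1_count natr_sum. Qed.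

Lemma nlarge_le : (nlarge st <= n)%N.
Proof.
rewrite -(ler_nat R) -nlargeE -[in leRHS](card_ord n) -sumr_const.
by rewrite [leRHS](bigID isL) /= lerDl sumr_ge0.
Qed.

(** The least item of an M_S-bin serves as [w]: domination at [w] counts all M_S-bins, and
    [inv_separated] against its bin gives the last clause. *)
Lemma least_marked : exists w, [/\ phi <= w <= 1 / 2,
  forall j, isM j -> w <= g j,
  \sum_(j | isM j) 1 <= n%:R * xi w
  & forall j, isL j -> phi <= g j \/ 1 - w <= load (bins st j)].
Proof.
have /andP[p1 p2] := phi_bounds R.
have gM j : isM j -> load (bins st j) = g j /\ phi <= g j <= 1 / 2.
  by move=> /eqP h; have := inv_bin I j; rewrite /bin_ok h.
have [/existsP[i iM]|] := boolP [exists j, isM j]; last first.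
  (* Without M_S-bins [w = 1/2] serves: [xi] vanishes there, and every L_+-bin has load above
     [1/2]. *)
  rewrite negb_exists => /forallP noM; exists (1 / 2); split => //.
  - by rewrite lexx andbT; lra.
  - by move=> j jM; have := noM j; rewrite jM.
  - rewrite xi_half mulr0 big1 // => j jM; by have := noM j; rewrite jM.
  - move=> j /eqP jL; right; have := inv_bin I j; rewrite /bin_ok jL.
    by have := bin_ok_marked_ge0 (inv_bin I j); move=> h [h1 h2 _]; lra.
case: (arg_minP g iM) => j jM jmin; have [jl jg] := gM j jM.
exists (g j); split => //.
- have gjD : g j \in marked st by apply: inv_mem I _ _; lra.
  have /allP/(_ _ gjD) := inv_dominated I.
  apply: le_trans; rewrite (inv_count I); last lra.
  rewrite natr_sum [leRHS](bigID isM) /=.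
  have : 0 <= \sum_(i | ~~ isM i) (g j <= g i)%R%:R :> R by apply: sumr_ge0 => ? _; exact: ler0n.
  have -> : \sum_(i | isM i) (g j <= g i)%R%:R = \sum_(i | isM i) 1 :> R.
    by apply: eq_bigr => k kM; rewrite jmin.
  lra.
- move=> k kL; have [h|h] := inv_separated I kL jM; first by left.
  by right; rewrite jl in h; lra.
Qed.

(** Of the loss 6, five units pay for the low bins and the rest for the 1 lost in [inv_tight]. *)
Lemma full_bins_value : rho * n%:R - 6 <= rta_value st.
Proof.
have /andP[p1 p2] := phi_bounds R; have /andP[r1 r2] := rta_ratio_bounds R.
have /andP[z1 z2] := inv_z0 I; have /andP[s1 s2] := @full_load_bounds R z0 z2.
have N0 : 1 <= n%:R :> R by rewrite ler1n.
have [w [/andP[w1 w2] wM mw wL]] := least_marked.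
have xw : 0 <= xi w by apply: xi_ge0; lra.
have okL j : isL j -> [/\ lg j + g j <= load (bins st j), 1 / 2 < lg j
    & g j = 0 \/ phi <= g j <= 1 / 2].
  by move=> /eqP h; have := inv_bin I j; rewrite /bin_ok h.
have okM j : isM j -> load (bins st j) = g j.
  by move=> /eqP h; have := inv_bin I j; rewrite /bin_ok h => -[].
have nE : n%:R = \sum_(j | isL j) 1 + \sum_(j | isM j) 1 + \sum_(j | isO j) 1 :> R.
  by rewrite -sum_LMO sumr_const card_ord.
have m0 : 0 <= \sum_(j | isM j) (1 : R) by apply: sumr_ge0.
rewrite (inv_value I) sum_LMO.
have ML : \sum_(j | isM j) load (bins st j) = \sum_(j | isM j) g j.
  by apply: eq_bigr => j /okM.
have Mw : w * \sum_(j | isM j) 1 <= \sum_(j | isM j) g j.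
  by rewrite mulr_sumr; apply: ler_sum => j /wM; rewrite mulr1.
rewrite {}ML.
have [w3|w3] := leP w (1 / 3).
  have L23 : 2 / 3 * (\sum_(j | isL j) 1) <= \sum_(j | isL j) load (bins st j).
    rewrite mulr_sumr; apply: ler_sum => j jL; rewrite mulr1.
    have [h1 h2 _] := okL j jL; case: (wL j jL) => h; lra.
  have O23 := other_load s1; have A := marked_bins_area w1 w3.
  have : 0 <= (n%:R * xi w - \sum_(j | isM j) 1) * (2 / 3 - w) by apply: mulr_ge0; lra.
  have : 0 <= n%:R * (2 / 3 - xi w * (2 / 3 - w) - rho) by apply: mulr_ge0; lra.
  move: nE L23 O23 Mw.
  move: (\sum_(j | isL j) 1) (\sum_(j | isM j) 1) (\sum_(j | isO j) 1).
  move: (\sum_(j | isL j) _) (\sum_(j | isM j) _) (\sum_(j | isO j) _) => a b c k m o.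
  lra.
have Os := other_load (lexx (full_load z0)).
move: (full_load z0) (@area_tight_below R w z0 z1) (@area_tight_above R w z0) s1 s2 Os.
move=> s below above s1 s2 Os.
set c := z0 + w - 1 / 2.
pose P : R := \sum_(j | isL j) (z0 <= g j)%R%:R.
pose M' : R := \sum_(j | isM j) (z0 <= g j)%R%:R.
have LP : \sum_(j | isL j) Num.max (lg j) (1 - w) + c * P <= \sum_(j | isL j) load (bins st j).
  rewrite mulr_sumr -big_split /=; apply: ler_sum => j jL.
  have [h1 h2 h3] := okL j jL; have := wL j jL => h4; exact: large_bin_load.
(* The terms [s] given away by the clamped sum are returned by the remaining bins, except for the
   M_S-bins. *)
have nks : (n%:R - \sum_(j | isL j) 1) * s =
    s * (\sum_(j | isM j) 1) + s * (\sum_(j | isO j) 1).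
  by rewrite nE; ring.
have LA : n%:R * clamped_area (1 - w) s - (n%:R - \sum_(j | isL j) 1) * s
    <= \sum_(j | isL j) Num.max (lg j) (1 - w).
  rewrite nlargeE -natrB ?nlarge_le //.
  apply: le_trans (@clamped_threshold_sum R n (nlarge st) (1 - w) s nlarge_le n_gt0 _ _ s2) _;
    [lra|lra|].
  rewrite (inv_large I (fun y => Num.max y (1 - w))).
  apply: le_trans (inv_threshold I (v := fun y => Num.max y (1 - w)) _).
    by apply: ler_sum => i _; rewrite ge_min lexx.
  by move=> a b ab; rewrite ge_max !le_max ab lexx orbT.
have PM : n%:R * xi z0 - 1 <= P + M'.
  apply: le_trans (inv_tight I) _; rewrite (inv_count I); last lra.
  rewrite natr_sum sum_LMO [X in _ + X]big1 ?addr0 // => j /andP[].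
  rewrite /labeled; have := inv_bin I j; rewrite /bin_ok.
  have z_gt0 : 0 < z0 by lra.
  by case: (bin_label _) => //=; rewrite ?eqxx ?andbF // => -[h1 h2] _ _;
    rewrite ?h1 ?h2 (lt_geF z_gt0).
have P0 : 0 <= P by apply: sumr_ge0 => j _; exact: ler0n.
have [zw|wz] := leP z0 w.
  have A := below zw w3 w2; rewrite -/c in A.
  have M'm : M' <= \sum_(j | isM j) 1.
    by apply: ler_sum => j _; case: (z0 <= g j).
  have c0 : 0 <= c by rewrite /c; lra.
  have h1 : 0 <= c * (P + M' - (n%:R * xi z0 - 1)) by apply: mulr_ge0; lra.
  have h2 : 0 <= c * (\sum_(j | isM j) 1 - M') by apply: mulr_ge0; lra.
  have h3 : 0 <= (n%:R * xi w - \sum_(j | isM j) 1) * (z0 - 1 / 2 + s).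
    by apply: mulr_ge0; lra.
  have h4 := ler_wpM2l (ler0n R n) A.
  move: nks LP LA Os Mw h1 h2 h3 h4.
  move: (\sum_(j | isL j) 1) (\sum_(j | isM j) 1) (\sum_(j | isO j) 1).
  move: (\sum_(j | isL j) Num.max _ _).
  move: (\sum_(j | isL j) _) (\sum_(j | isM j) _) (\sum_(j | isO j) _).
  move=> lL lM lO mx k m o nks LP LA Os Mw h1 h2 h3 h4.
  rewrite /c in LP h1 h2 h4; lra.
have A := above (ltW wz) z2 w3.
have M'g : w * \sum_(j | isM j) 1 + (z0 - w) * M' <= \sum_(j | isM j) g j.
  rewrite !mulr_sumr -big_split /=; apply: ler_sum => j /wM h.
  by case: (leP z0 (g j)) => h'; rewrite ?mulr1 ?mulr0; lra.
have h1 : 0 <= (z0 - w) * (P + M' - (n%:R * xi z0 - 1)) by apply: mulr_ge0; lra.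
(* [2 * w - 1/2] is the excess of the gain [c] over the credited [z0 - w]. *)
have h2 : 0 <= (2 * w - 1 / 2) * P by apply: mulr_ge0; lra.
have h3 : 0 <= (n%:R * xi w - \sum_(j | isM j) 1) * (s - w) by apply: mulr_ge0; lra.
have h4 := ler_wpM2l (ler0n R n) A.
move: nks LP LA Os M'g h1 h2 h3 h4.
move: (\sum_(j | isL j) 1) (\sum_(j | isM j) 1) (\sum_(j | isO j) 1).
move: (\sum_(j | isL j) Num.max _ _).
move: (\sum_(j | isL j) _) (\sum_(j | isM j) _) (\sum_(j | isO j) _).
move=> lL lM lO mx k m o nks LP LA Os M'g h1 h2 h3 h4.
rewrite /c in LP; lra.
Qed.

End FullBins.

(** * An empty bin remains *)

Section Optimum.
Variables (R : realType) (n : nat) (s : seq R).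
Hypothesis s_gt0 : forall x, x \in s -> 0 < x.

Lemma nth_ge0 (i : 'I_(size s)) : 0 <= s`_i.
Proof. by rewrite ltW // s_gt0 // mem_nth. Qed.

Lemma opt_le (B : R) : 0 <= B ->
  (forall A : {set 'I_(size s)}, packable n A -> \sum_(i in A) s`_i <= B) ->
  opt n s <= B.
Proof. by move=> B0 h; apply: bigmax_le. Qed.

Lemma opt_ge0 : 0 <= opt n s.
Proof. by rewrite /opt bigmax_idl le_max lexx. Qed.

Lemma opt_le_bins : opt n s <= n%:R.
Proof.
apply: opt_le => // A /existsP[p /forallP pA].
rewrite (partition_big p xpredT) //= -[in leRHS](card_ord n) -sumr_const.
by apply: ler_sum => j _.
Qed.

Lemma subset_sum_le (v : R -> R) (A : {set 'I_(size s)}) :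
  (forall x, x \in s -> 0 <= v x) -> \sum_(i in A) v s`_i <= \sum_(x <- s) v x.
Proof.
move=> v0; rewrite [leRHS](big_nth 0) big_mkord.
rewrite [leRHS](bigID (fun i => i \in A)) /= lerDl.
by apply: sumr_ge0 => i _; rewrite v0 // mem_nth.
Qed.

Lemma opt_le_sum : opt n s <= \sum_(x <- s) x.
Proof.
apply: opt_le => [|A _].
  by rewrite big_seq_cond; apply: sumr_ge0 => x; rewrite andbT => /s_gt0/ltW.
by apply: (@subset_sum_le id) => x /s_gt0/ltW.
Qed.

Definition residual (th x : R) : R := if large x then Num.max (x - th) 0 else x.

Lemma residual_ge0 th x : 0 < x -> 0 <= residual th x.
Proof. by rewrite /residual; case: ifP => _ /ltW // _; rewrite le_max lexx orbT. Qed.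

(* Every bin holds at most one large item, which exceeds its residual by at *)
(* most th.                                                                 *)
Lemma opt_le_residual th : 0 <= th ->
  opt n s <= n%:R * th + \sum_(x <- s) residual th x.
Proof.
move=> th0.
have r0 x : x \in s -> 0 <= residual th x by move=> /s_gt0/residual_ge0.
apply: opt_le => [|A /existsP[p /forallP pA]].
  rewrite addr_ge0 ?mulr_ge0 // big_seq_cond; apply: sumr_ge0 => x.
  by rewrite andbT => /r0.
apply: (@le_trans _ _ (n%:R * th + \sum_(i in A) residual th s`_i)); last first.
  by rewrite lerD2l subset_sum_le.
rewrite (partition_big p xpredT) //= [X in _ <= _ + X](partition_big p xpredT) //=.
have -> : n%:R * th = \sum_(j < n) th by rewrite sumr_const card_ord mulr_natl.
rewrite -big_split /=; apply: ler_sum => j _.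
have := pA j; set P := fun i => (i \in A) && (p i == j) => pAj.
have [/existsP[i /andP[Pi li]]|] := boolP [exists i, P i && large s`_i]; last first.
  rewrite negb_exists => /forallP nl; rewrite ler_wpDl //; apply: ler_sum => i Pi.
  by have := nl i; rewrite /P Pi /residual /= => /negPf ->.
rewrite (bigD1 i Pi) /= in pAj.
rewrite [leLHS](bigD1 i Pi) /= [X in _ <= _ + X](bigD1 i Pi) /= addrA lerD //.
  by rewrite /residual li; case: (leP (s`_i - th) 0) => ?; lra.
apply: ler_sum => k /andP[Pk ki]; rewrite /residual; case: ifP => // lk.
rewrite (bigD1 k) /= in pAj; last by rewrite Pk.
have : 0 <= \sum_(l | (P l && (l != i)) && (l != k)) s`_l.
  by apply: sumr_ge0 => l _; exact: nth_ge0.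
by move: lk li; rewrite /large; lra.
Qed.

End Optimum.

(** * Accepted items along a run *)

Section Runs.
Variables (R : realType) (n : nat).
Implicit Types (st : state R n) (s : seq R) (x : R).

Lemma rta_process_accepted st x st' : rta_process st x st' ->
  accepted st' = x :: accepted st \/
  [/\ st' = st, large x & x < threshold ((nlarge st).+1%:R / n%:R)].
Proof. by case=> *; [right|left..]. Qed.

Lemma rta_process_empty st x st' : rta_process st x st' ->
  exists_labeled st' LE -> exists_labeled st LE.
Proof.
move=> h /existsP[i]; suff H : labeled st' LE i -> labeled st LE i.
  by move=> /H hi; apply/existsP; exists i.
apply: contraTT; case: h => *; first by [].
all: rewrite /labeled /= !ffunE; case: (i == _) => //; apply/eqP => //=.
all: by case: (category_cases x) => ->.
Qed.

Lemma rta_run_empty s st st' : rta_run st s st' ->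
  exists_labeled st' LE -> exists_labeled st LE.
Proof.
elim: s st => [|x s IH] st /=; first by move=> ->.
case=> st1 [_ /IH//|st2 _ /rta_process_empty h] hr hE.
exact/h/(IH _ hr hE).
Qed.

Lemma rta_run_nlarge s st st' : rta_run st s st' -> (nlarge st <= nlarge st')%N.
Proof.
elim: s st => [|x s IH] st /=; first by move=> ->.
case=> st1 [_ /IH//|st2 _ h] /IH; apply: leq_trans.
case: (rta_process_accepted h) => [E|[-> _ _]//].
by rewrite /nlarge E /= leq_addl.
Qed.

(** An empty bin at the end rules out termination, so every rejected item is large and below the
    threshold of its time. Thresholds rise with [nlarge], so it is also below the final one, where
    [v] vanishes. *)
Lemma rta_run_accepted (v : R -> R) s st st' :
  rta_run st s st' -> exists_labeled st' LE ->
  (forall x, large x -> x < threshold ((nlarge st').+1%:R / n%:R) -> v x = 0) ->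
  \sum_(x <- accepted st') v x = \sum_(x <- accepted st) v x + \sum_(x <- s) v x.
Proof.
move=> + hE hv; elim: s st => [|x s IH] st /=; first by move=> ->; rewrite big_nil addr0.
case=> st1 [nE|st2 _ h] hr; first by rewrite (rta_run_empty hr hE) in nE.
rewrite (IH _ hr) big_cons addrA; congr (_ + _).
case: (rta_process_accepted h) => [->|[E lx xt]]; first by rewrite big_cons addrC.
rewrite E hv ?addr0 //; apply: lt_le_trans xt _; apply: threshold_homo.
rewrite ler_wpM2r ?invr_ge0 // ler_nat ltnS -E.
exact: rta_run_nlarge hr.
Qed.

End Runs.

Section EmptyBin.
Variables (R : realType) (n : nat).
Local Notation rho := (rta_ratio R).

Lemma nlarge_lt (st : state R n) g lg z0 :
  invariant st g lg z0 -> exists_labeled st LE -> (nlarge st < n)%N.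
Proof.
move=> I /existsP[e /eqP eE]; rewrite -(ltr_nat R) -(nlargeE I).
rewrite -[in ltRHS](card_ord n) -sumr_const [ltRHS](bigID (labeled st LL)) /= ltrDl.
rewrite (bigD1 e) /=; last by rewrite /labeled eE; apply/eqP.
by rewrite ltr_pwDl // sumr_ge0.
Qed.

(** If [th <= 1/2], nothing was rejected. Otherwise [V] is the residual volume, and clamping the
    thresholds to [[1/2, th]] bounds the rest of the large items. *)
Lemma empty_bin_value (s : seq R) (st : state R n) g lg z0 :
  (forall x, x \in s -> 0 < x) -> (0 < n)%N ->
  rta_run (rta_init R n) s st -> invariant st g lg z0 -> exists_labeled st LE ->
  opt n s <= rta_value st \/
  exists th V, [/\ 1 / 2 <= th <= 1, 0 <= V, opt n s <= n%:R * th + V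
    & V + (n%:R * rho - 1) * th <= rta_value st].
Proof.
move=> s0 n0 hr I hE; have /andP[r1 r2] := rta_ratio_bounds R.
have N0 : 0 < n%:R :> R by rewrite ltr0n.
pose th : R := threshold ((nlarge st).+1%:R / n%:R).
have kn := nlarge_lt I hE.
have th1 : th <= 1.
  by apply: threshold_le1; rewrite ler_pdivrMr // mul1r ler_nat.
have th2 : 1 / 2 <= th := threshold_ge_half _.
have [thle|thgt] := leP th (1 / 2).
  left; have := @rta_run_accepted _ _ id _ _ _ hr hE.
  rewrite big_nil add0r -/(rta_value st) => -> //; first exact: opt_le_sum.
  by move=> x; rewrite /large -/th => ? ?; lra.
have E := @rta_run_accepted _ _ (residual th) _ _ _ hr hE.
rewrite big_nil add0r in E.
right; exists th, (\sum_(x <- s) residual th x); split.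
- by rewrite th1 th2.
- rewrite big_seq_cond; apply: sumr_ge0 => x; rewrite andbT => /s0 ?.
  exact: residual_ge0.
- by apply: opt_le_residual => //; lra.
rewrite -{}E; last first.
  by move=> x lx; rewrite -/th => xt; rewrite /residual lx max_r //; lra.
have lnth : ln th = ((nlarge st).+1%:R / n%:R - 1) / rho.
  have : th = Num.max (1 / 2) (expR (((nlarge st).+1%:R / n%:R - 1) / rho)) by exact: thresholdE.
  by case: leP => h thE; [rewrite thE expRK|lra].
have := @clamped_threshold_sum R n (nlarge st) (1 / 2) th (ltnW kn) n0 (lexx _) th2 th1.
(* At [t = 1/2] the term [t * ln (2 * t)] vanishes, and the formula for [ln th] cancels [n - k] up
   to 1, because [th] is taken at index [k + 1]. *)
have -> : n%:R * clamped_area (1 / 2) th - (n - nlarge st)%:R * th = (n%:R * rho - 1) * th.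
  rewrite /clamped_area lnth (_ : 2 * (1 / 2) = 1 :> R); last by field.
  rewrite ln1 natrB ?(ltnW kn) // -[(nlarge st).+1%:R]natr1.
  by field; rewrite !gt_eqF //; lra.
have homo : {homo (fun y => Num.min (Num.max y (1 / 2)) th) : x y / x <= y}.
  move=> x y xy /=; rewrite le_min !ge_min lexx orbT andbT; apply/orP; left.
  by rewrite ge_max !le_max xy lexx orbT.
move=> /le_trans /(_ (inv_threshold I homo)) H.
suff -> : rta_value st = \sum_(x <- accepted st) residual th x +
    \sum_(x <- accepted st | large x) Num.min (Num.max x (1 / 2)) th by rewrite lerD2l.
rewrite [X in _ + X]big_mkcond -big_split /=; apply: eq_bigr => x _.
rewrite /residual; case: ifP => lx; last by rewrite addr0.
rewrite (max_l (ltW lx)); case: (leP x th) => xt.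
  by rewrite max_r ?add0r // subr_le0.
by rewrite max_l ?subrK // subr_ge0 ltW.
Qed.

End EmptyBin.

(** * Competitive ratio from the two cases *)

Theorem theorem22 (R : realType) :
  exists C : R, 0 < C /\
    forall (n : nat) (s : seq R) (st : state R n),
      (1 <= n)%N ->
      (forall x, x \in s -> 0 < x <= 1) ->
      rta_run (rta_init R n) s st ->
      rta_value st >= (rta_ratio R - C / n%:R) * opt n s.
Proof.
(* 8 covers both the loss 6 with full bins and the loss [th <= 1] with an empty bin. *)
exists 8; split => // n s st n0 s01 hr.
have s0 x : x \in s -> 0 < x by move=> /s01/andP[].
have [g [lg [z0 I]]] := rta_run_invariant s0 (rta_init_invariant R n) hr.
have /andP[r1 r2] := rta_ratio_bounds R.
have N0 : 0 < n%:R :> R by rewrite ltr0n.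
have V0 : 0 <= rta_value st.
  by rewrite (inv_value I); apply: sumr_ge0 => j _; exact: bin_ok_load_ge0 (inv_bin I j).
have O0 : 0 <= opt n s := opt_ge0 n s.
have [neg|pos] := leP (rta_ratio R - 8 / n%:R) 0.
  by apply: le_trans V0; rewrite mulr_le0_ge0.
have c0 := ltW pos.
have cn : (rta_ratio R - 8 / n%:R) * n%:R = rta_ratio R * n%:R - 8.
  by rewrite mulrBl divfK // gt_eqF.
have q0 : 0 < 8 / n%:R :> R by rewrite divr_gt0.
have [hE|hE] := boolP (exists_labeled st LE); last first.
  apply: le_trans (full_bins_value n0 I hE).
  by apply: le_trans (ler_wpM2l c0 (opt_le_bins n s)) _; rewrite cn; lra.
case: (empty_bin_value s0 n0 hr I hE) => [h|[th [V [/andP[t1 t2] V1 h1 h2]]]].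
  by apply: le_trans h; rewrite ler_piMl //; lra.
apply: le_trans h2; apply: le_trans (ler_wpM2l c0 h1) _.
rewrite mulrDr mulrA cn.
have : (rta_ratio R - 8 / n%:R) * V <= V by rewrite ler_piMl //; lra.
nra.
Qed.
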